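(* Let $F$ be a field of characteristic $2$ and let $K/F$ be an inseparable quadratic field extension. Let $A$ be a central simple $K$-algebra of exponent $2$ and assume that $m\geq 1$ is an integer such that $A$ is Brauer equivalent to a tensor product of $m$ $K$-quaternion algebras. Assume that $\mathrm{Frob}_{K/F}([A])=0$ in $\mathrm{Br}_2(F)$. Then there exist $F$-quaternion algebras $H_1,\ldots,H_n$ with $n\leq 2m-1$ such that $A$ is Brauer equivalent to $\left(\bigotimes_{i=1}^{n}H_i\right)\otimes_F K$.
   Context: $F$ is a field of characteristic $2$. A quaternion algebra over a field is a central simple algebra of degree $2$ over it. The exponent of a central simple algebra is the order of its class in the Brauer group. $\mathrm{Br}_2(F)$ denotes the $2$-torsion subgroup of the Brauer group of $F$, written additively. For $a\in F$ and $b\in F^\times$, $[a,b)_F$ denotes the $F$-quaternion algebra generated by $i,j$ with relations $i^2+i=a$, $j^2=b$, $ji=(1+i)j$. Let $K/F$ be a purely inseparable field extension with $K^2\subseteq F$ (e.g. an inseparable quadratic extension). The ring homomorphism $K\to F$, $x\mapsto x^2$, induces by scalar extension a group homomorphism $\mathrm{Frob}_{K/F}:\mathrm{Br}_2(K)\to\mathrm{Br}_2(F)$, sending $[A]$ to the class of $A\otimes_K F$, where $F$ is viewed as a $K$-algebra via $x\mapsto x^2$. For $x\in K$ and $y\in K^\times$ one has $\mathrm{Frob}_{K/F}([[x,y)_K])=[[x^2,y^2)_F]$. *)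

(* Defs.v *)
From HB Require Import structures.
From mathcomp Require Import all_boot all_order all_algebra all_field.

Set Implicit Arguments.
Unset Strict Implicit.
Unset Printing Implicit Defensive.

Import GRing.Theory.
Local Open Scope ring_scope.

(* [tensor phi A B] is the L-algebra A ⊗_K B, where A is a K-algebra, B is an *)
(* L-algebra and L is viewed as a K-algebra via phi. An element is the matrix *)
(* of its coordinates in the L-basis (e_i ⊗ f_j), for (e_i) and (f_j) the     *)
(* [vbasis] of A and B; [tpure phi a b] is the pure tensor a ⊗ b.             *)
Definition tensor (K L : fieldType) (phi : {rmorphism K -> L})
  (A : falgType K) (B : falgType L) : Type := 'M[L]_(\dim {:A}, \dim {:B}).

HB.instance Definition _ (K L : fieldType) (phi : {rmorphism K -> L})
    (A : falgType K) (B : falgType L) :=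
  Vector.copy (tensor phi A B) 'M[L]_(\dim {:A}, \dim {:B}).

Section TensorAlgebra.

Variables (K L : fieldType) (phi : {rmorphism K -> L}).
Variables (A : falgType K) (B : falgType L).

Local Notation T := (tensor phi A B).
Local Notation e i := (vbasis {:A})`_i.
Local Notation f j := (vbasis {:B})`_j.

Definition tpure (a : A) (b : B) : T :=
  \matrix_(i, j) (phi (coord (vbasis {:A}) i a) * coord (vbasis {:B}) j b).

Definition tmul (x y : T) : T :=
  \sum_i \sum_j \sum_k \sum_l
    ((x : 'M_(_, _)) i j * (y : 'M_(_, _)) k l) *: tpure (e i * e k) (f j * f l).

Definition tone : T := tpure 1 1.

Lemma tpureDl a a' b : tpure (a + a') b = tpure a b + tpure a' b.
Proof. by apply/matrixP=> i j; rewrite !mxE !raddfD /= mulrDl. Qed.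

Lemma tpureDr a b b' : tpure a (b + b') = tpure a b + tpure a b'.
Proof. by apply/matrixP=> i j; rewrite !mxE raddfD /= mulrDr. Qed.

Lemma tpureZl c a b : tpure (c *: a) b = phi c *: tpure a b.
Proof. by apply/matrixP=> i j; rewrite !mxE linearZ /= rmorphM mulrA. Qed.

Lemma tpureZr c a b : tpure a (c *: b) = c *: tpure a b.
Proof. by apply/matrixP=> i j; rewrite !mxE linearZ /= mulrCA. Qed.

Lemma tpure0l b : tpure 0 b = 0.
Proof. by rewrite -(scale0r (0 : A)) tpureZl rmorph0 scale0r. Qed.

Lemma tpure0r a : tpure a 0 = 0.
Proof. by rewrite -(scale0r (0 : B)) tpureZr scale0r. Qed.

Lemma tpure_suml I r (P : pred I) F b :
  tpure (\sum_(i <- r | P i) F i) b = \sum_(i <- r | P i) tpure (F i) b.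
Proof. by apply: (big_morph (tpure^~ b)) => [x y|]; rewrite ?tpureDl ?tpure0l. Qed.

Lemma tpure_sumr I r (P : pred I) F a :
  tpure a (\sum_(i <- r | P i) F i) = \sum_(i <- r | P i) tpure a (F i).
Proof. by apply: (big_morph (tpure a)) => [x y|]; rewrite ?tpureDr ?tpure0r. Qed.

Lemma tensor_decomp (x : T) :
  x = \sum_i \sum_j (x : 'M_(_, _)) i j *: tpure (e i) (f j).
Proof.
apply/matrixP=> k l; rewrite summxE (bigD1 k) //= [X in _ + X]big1 => [|i nik].
  rewrite addr0 summxE (bigD1 l) //= big1 => [|j njl].
    rewrite !mxE !coord_free ?(basis_free (vbasisP _)) // !eqxx.
    by rewrite rmorph1 !mulr1 addr0.
  rewrite !mxE !coord_free ?(basis_free (vbasisP _)) //.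
  by rewrite (negPf njl) !mulr0.
rewrite summxE big1 // => j _; rewrite !mxE coord_free ?(basis_free (vbasisP _)) //.
by rewrite (negPf nik) rmorph0 mul0r mulr0.
Qed.

Lemma tensor_ind (P : T -> Prop) :
  P 0 -> (forall x y, P x -> P y -> P (x + y)) ->
  (forall c a b, P (c *: tpure a b)) -> forall x, P x.
Proof.
move=> P0 PD PZ x; rewrite (tensor_decomp x).
by elim/big_ind: _ => // i _; elim/big_ind: _.
Qed.

Lemma tmulDl : left_distributive tmul +%R.
Proof.
move=> x y z; rewrite /tmul -big_split; apply: eq_bigr => i _.
rewrite -big_split; apply: eq_bigr => j _; rewrite -big_split.
apply: eq_bigr => k _; rewrite -big_split; apply: eq_bigr => l _.
by rewrite mxE mulrDl scalerDl.
Qed.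

Lemma tmulDr : right_distributive tmul +%R.
Proof.
move=> x y z; rewrite /tmul -big_split; apply: eq_bigr => i _.
rewrite -big_split; apply: eq_bigr => j _; rewrite -big_split.
apply: eq_bigr => k _; rewrite -big_split; apply: eq_bigr => l _.
by rewrite mxE mulrDr scalerDl.
Qed.

Lemma tmulZl c x y : tmul (c *: x) y = c *: tmul x y.
Proof.
rewrite /tmul !scaler_sumr; apply: eq_bigr => i _; rewrite scaler_sumr.
apply: eq_bigr => j _; rewrite scaler_sumr; apply: eq_bigr => k _.
rewrite scaler_sumr; apply: eq_bigr => l _.
by rewrite mxE -mulrA scalerA.
Qed.

Lemma tmulZr c x y : tmul x (c *: y) = c *: tmul x y.
Proof.
rewrite /tmul !scaler_sumr; apply: eq_bigr => i _; rewrite scaler_sumr.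
apply: eq_bigr => j _; rewrite scaler_sumr; apply: eq_bigr => k _.
rewrite scaler_sumr; apply: eq_bigr => l _.
by rewrite mxE mulrCA scalerA.
Qed.

Lemma tmul_pure a b a' b' :
  tmul (tpure a b) (tpure a' b') = tpure (a * a') (b * b').
Proof.
rewrite /tmul {2}(coord_vbasis (memvf a)) {2}(coord_vbasis (memvf a')).
rewrite {2}(coord_vbasis (memvf b)) {2}(coord_vbasis (memvf b')).
rewrite mulr_suml tpure_suml; apply: eq_bigr => i _.
rewrite mulr_suml tpure_sumr; apply: eq_bigr => j _.
rewrite mulr_sumr tpure_suml; apply: eq_bigr => k _.
rewrite mulr_sumr tpure_sumr; apply: eq_bigr => l _.
rewrite -!scalerAl -!scalerAr !tpureZl !tpureZr !scalerA !mxE.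
by congr (_ *: _); rewrite -!mulrA; congr (_ * _); rewrite mulrCA.
Qed.

Lemma tmul0l x : tmul 0 x = 0.
Proof. by apply: (addrI (tmul 0 x)); rewrite -tmulDl !addr0. Qed.

Lemma tmul0r x : tmul x 0 = 0.
Proof. by apply: (addrI (tmul x 0)); rewrite -tmulDr !addr0. Qed.

Lemma tmulA : associative tmul.
Proof.
move=> x y z; elim/tensor_ind: x => [|x x' IH IH'|c a b].
- by rewrite !tmul0l.
- by rewrite !tmulDl IH IH'.
elim/tensor_ind: y => [|y y' IH IH'|c' a' b'].
- by rewrite tmul0r !tmul0l tmul0r.
- by rewrite !(tmulDl, tmulDr) IH IH'.
elim/tensor_ind: z => [|z z' IH IH'|c'' a'' b''].
- by rewrite !tmul0r.
- by rewrite !tmulDr IH IH'.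
rewrite !(tmulZl, tmulZr, tmul_pure) !mulrA !scalerA.
by rewrite -(mulrA c'') (mulrC c'').
Qed.

Lemma tmul1l : left_id tone tmul.
Proof.
elim/tensor_ind=> [|x y IHx IHy|c a b]; first exact: tmul0r.
  by rewrite tmulDr IHx IHy.
by rewrite tmulZr tmul_pure !mul1r.
Qed.

Lemma tmul1r : right_id tone tmul.
Proof.
elim/tensor_ind=> [|x y IHx IHy|c a b]; first exact: tmul0l.
  by rewrite tmulDl IHx IHy.
by rewrite tmulZl tmul_pure !mulr1.
Qed.

Lemma tone_neq0 : tone != 0.
Proof.
have nz (k : fieldType) (C : falgType k) :
    exists i, coord (vbasis {:C}) i 1 != 0.
  apply/existsP; rewrite -negb_forall; apply/negP=> /forallP C0.
  have /eqP[] := oner_neq0 C; rewrite (coord_vbasis (memvf 1)).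
  by rewrite big1 // => i _; rewrite (eqP (C0 i)) scale0r.
have [[i nzi] [j nzj]] := (nz _ A, nz _ B).
apply/eqP=> /matrixP/(_ i j)/eqP; rewrite !mxE mulf_eq0 fmorph_eq0.
by rewrite (negPf nzi) (negPf nzj).
Qed.

HB.instance Definition _ := GRing.Zmodule_isNzRing.Build T
  tmulA tmul1l tmul1r tmulDl tmulDr tone_neq0.
HB.instance Definition _ := GRing.Lmodule_isLalgebra.Build L T
  (fun c x y => esym (tmulZl c x y)).
HB.instance Definition _ := GRing.Lalgebra_isAlgebra.Build L T
  (fun c x y => esym (tmulZr c x y)).
HB.instance Definition _ := Algebra_isFalgebra.Build L T.

Lemma tpureM a b a' b' :
  tpure a b * tpure a' b' = tpure (a * a') (b * b') :> T.
Proof. exact: tmul_pure. Qed.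

Lemma tpure1 : tpure 1 1 = 1 :> T.
Proof. by []. Qed.

End TensorAlgebra.

Definition tensalg (K : fieldType) (A B : falgType K) : falgType K :=
  tensor (idfun : {rmorphism K -> K}) A B.

Definition bigtens (K : fieldType) (n : nat) (A : 'I_n -> falgType K) :
  falgType K := \big[@tensalg K/K^o : falgType K]_(i < n) A i.

(* A ⊗_K L, for L viewed as a K-algebra via phi *)
Definition scalar_ext (K L : fieldType) (phi : {rmorphism K -> L})
  (A : falgType K) : falgType L := tensor phi A L^o.

Section BrauerEquivalence.

Variable K : fieldType.
Implicit Types A B : falgType K.

(* In a finite-dimensional unital algebra every ideal is a subspace. *)
Definition central_simple A : Prop :=
  'Z({:A})%VS = 1%VS /\
  forall I : {vspace A}, ({:A} * I <= I)%VS -> (I * {:A} <= I)%VS ->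
    I = 0%VS \/ I = {:A}%VS.

Definition quaternion_algebra A : Prop :=
  central_simple A /\ \dim {:A} = (2 ^ 2)%N.

Definition alg_isom A B : Prop := exists h : {lrmorphism A -> B}, bijective h.

Definition brauer_equiv A B : Prop :=
  exists r s : nat, alg_isom (tensalg A 'M[K]_r.+1) (tensalg B 'M[K]_s.+1).

Definition brauer_trivial A : Prop := brauer_equiv A K^o.

(* e is the order of the class of A in the Brauer group *)
Definition has_exponent A (e : nat) : Prop :=
  [/\ (0 < e)%N, brauer_trivial (bigtens (fun _ : 'I_e => A))
    & forall d, (0 < d < e)%N -> ~ brauer_trivial (bigtens (fun _ : 'I_d => A))].

End BrauerEquivalence.

Section Frobenius.

Variables (F : fieldType) (K : fieldExtType F).
Hypotheses (charF2 : 2%N \in [pchar F]) (sqK : forall x : K, x ^+ 2 \in 1%VS).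

(* The element of F equal to x ^+ 2. *)
Definition frobenius of 2%N \in [pchar F] & (forall x : K, x ^+ 2 \in 1%VS) :=
  fun x : K => coord [tuple (1 : K)] ord0 (x ^+ 2).

Local Notation frob := (frobenius charF2 sqK).

Lemma frobeniusE x : (frob x)%:A = x ^+ 2.
Proof.
have sx : x ^+ 2 \in <<[tuple (1%R : K)]>>%VS by rewrite span_seq1.
by rewrite [RHS](coord_span sx) big_ord1.
Qed.

Fact frobenius_is_additive : zmod_morphism frob.
Proof.
move=> x y; apply: (fmorph_inj (in_alg K)); rewrite rmorphB /= !frobeniusE.
have charK2 : 2%N \in [pchar K] by rewrite pchar_lalg.
exact: (rmorphB (pFrobenius_aut charK2)).
Qed.

Fact frobenius_is_monoid_morphism : monoid_morphism frob.
Proof.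
split=> [|x y]; apply: (fmorph_inj (in_alg K)).
  by rewrite /= frobeniusE expr1n scale1r.
by rewrite rmorphM /= !frobeniusE exprMn.
Qed.

HB.instance Definition _ :=
  GRing.isZmodMorphism.Build K F frob frobenius_is_additive.
HB.instance Definition _ :=
  GRing.isMonoidMorphism.Build K F frob frobenius_is_monoid_morphism.

End Frobenius.

Lemma insep_quadratic_sqr (F : fieldType) (K : fieldExtType F) :
  2%N \in [pchar F] -> \dim {:K} = 2%N -> ~~ separable 1 {:K} ->
  forall x : K, x ^+ 2 \in 1%VS.
Proof.
move=> charF2 dimK /allPn[y _ insep_y] x.
have charK2 : 2%N \in [pchar K] by rewrite pchar_lalg.
have nFy : y \notin <<1; y ^+ 2>>%VS.
  by rewrite -(@pcharf_p_separable _ _ 1%AS y 0 2 charK2).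
have dim12 (E : {subfield K}) : (\dim E == 1) || (\dim E == 2)%N.
  have := field_dimS (subvf E); rewrite dimK; have := adim_gt0 E.
  by case: (\dim E) => [|[|[|n]]] // _ /dvdn_leq.
have y2F : y ^+ 2 \in 1%VS.
  have /orP[d1|d2] := dim12 <<1; y ^+ 2>>%AS.
    have /eqP -> : (1 == <<1; y ^+ 2>>)%VS.
      by rewrite eqEdim dimv1 (eqP d1) sub1v andbT.
    exact: memv_adjoin.
  case/negP: nFy; have /eqP -> : (<<1; y ^+ 2>> == {:K})%VS.
    by rewrite eqEdim subvf dimK (eqP d2).
  exact: memvf.
have freeY : free [:: 1; y].
  rewrite free_cons seq1_free span_seq1; apply/andP; split.
    apply: contra nFy => /vlineP[c y1].
    have c0 : c != 0.
      by apply/eqP=> c0; move/eqP: y1; rewrite c0 scale0r oner_eq0.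
    rewrite -(scalerK c0 y) -y1 memvZ //.
    exact: (mem1v (agenv _)).
  by apply: contraNneq nFy => ->; rewrite mem0v.
have: x \in <<[:: 1%R; y]>>%VS.
  suff /eqP -> : (<<[:: 1%R; y]>> == {:K})%VS by apply: memvf.
  by rewrite eqEdim subvf dimK (eqP freeY).
rewrite span_cons span_seq1 => /memv_addP[_ /vlineP[a ->] [_ /vlineP[b ->] ->]].
have -> : (a%:A + b *: y) ^+ 2 = a%:A ^+ 2 + (b *: y) ^+ 2.
  exact: (rmorphD (pFrobenius_aut charK2)).
by rewrite !exprZn expr1n memvD // memvZ // mem1v.
Qed.

(* Main.v *)
From HB Require Import structures.
Require Import Defs.
From Stdlib Require Import Classical.
From mathcomp Require Import all_boot all_order all_algebra all_field.
From mathcomp Require Import ring zify mxtens.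

(* Every quaternion K-algebra is a symbol [a, b), and [a, b) = [a^2, b) with    *)
(* a^2 in F. If b_1 is not in F then K = F + F b_1, and generically             *)
(* b_2 = x (1 + z) with z = w b_1 and x, w in F. Bilinearity of symbols and     *)
(* [a_2, 1 + z) = [c, z), where c = a_2 z / (1 + z), give                       *)
(*   [a_1, b_1) + [a_2, b_2) = [a_1 + c, b_1) + [a_2^2, x) + [c^2, w),          *)
(* and the last two symbols are defined over F. By induction A is a single      *)
(* symbol [a, b) over K plus at most 2 (m - 1) symbols defined over F. The      *)
(* latter are killed by Frob, which maps the restriction of [c, d) to           *)
(* [c^2, d^2) = 0. Hence [a^2, b^2)_F = 0, that is b^2 = s^2 + s t + a^2 t^2    *)
(* with s, t in F. If t = 0 then b = s lies in F; otherwise                     *)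
(* [a, b) = [b / t, b) = [b / t, t) + [b / t, b / t) = [b^2 / t^2, t).          *)

Set Implicit Arguments.
Unset Strict Implicit.
Unset Printing Implicit Defensive.
Import GRing.Theory.
Local Open Scope ring_scope.

(** * Isomorphisms of tensor products *)

(** The first slot of a symbol is harmless: [a, b) = [a^2, b) by [quat_sqr], and squares of K lie in
    F, so only second slots have to be moved into F ([symbols_descent]). Four lemmas carry the
    argument. [quaternionP] presents every quaternion algebra as a symbol. [symbols_merge], iterated
    by [symbols_reduce], trades two symbols over K for one symbol plus at most two coming from F.
    [quat_split_norm] turns the triviality of [a^2, b^2) over F into a norm equation, and
    [symbol_frob_split] reads off from that equation a symbol over F equivalent to [a, b). The count
    is 1 + 2 (m - 1) = 2 m - 1. Brauer equivalence is handled directly as isomorphism up to matrix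
    factors. The symbol calculus ([quat_shift], [quat_slot], [symbol_mul], [symbol_add]) consists of
    changes of generators: new elements satisfying the quaternion relations are exhibited, and
    simplicity or generation together with a dimension count gives an isomorphism. *)

Lemma lrmorphism_of (K : fieldType) (A B : falgType K) (f : A -> B) :
  linear f -> monoid_morphism f -> {h : {lrmorphism A -> B} | h =1 f}.
Proof.
move=> fL fM.
pose hl := GRing.isLinear.Build K A B *:%R f fL.
pose hm := GRing.isMonoidMorphism.Build A B f fM.
pose h : {lrmorphism A -> B} := HB.pack f hl hm.
by exists h.
Qed.

Lemma surj_bij (K : fieldType) (U V : vectType K) (h : {linear U -> V}) :
  \dim {:U} = \dim {:V} -> (forall y, exists x, h x = y) -> bijective h.
Proof.
move=> dUV hS; pose f := linfun h.
have fl : limg f = fullv.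
  apply/vspaceP=> y; rewrite memvf; have [x <-] := hS y.
  by rewrite -(lfunE h x) memv_img ?memvf.
have k0 : lker f == 0%VS.
  have := limg_ker_dim f fullv; rewrite fl -dUV capfv -dimv_eq0 => /eqP.
  by rewrite -[X in _ == X]add0n eqn_add2r.
exists (f^-1)%VF => x.
  by rewrite -(lfunE h) lker0_lfunK.
by rewrite -[LHS](lfunE h) limg_lfunVK // fl memvf.
Qed.

Lemma inj_bij (K : fieldType) (U V : vectType K) (h : {linear U -> V}) :
  \dim {:U} = \dim {:V} -> injective h -> bijective h.
Proof.
move=> dUV hI; apply: surj_bij => // y; pose f := linfun h.
have k0 : lker f == 0%VS.
  by apply/lker0P=> x x'; rewrite !lfunE; apply: hI.
have fl : limg f = fullv.
  by apply/eqP; rewrite eqEdim subvf -dUV limg_dim_eq ?(eqP k0) ?capv0 /=.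
by exists ((f^-1)%VF y); rewrite -[LHS](lfunE h) limg_lfunVK // fl memvf.
Qed.

Lemma dim_tensor (K L : fieldType) (phi : {rmorphism K -> L})
  (A : falgType K) (B : falgType L) :
  \dim {:tensor phi A B} = (\dim {:A} * \dim {:B})%N.
Proof. by rewrite [LHS]dimvf. Qed.

Section TensorLift.
Variables (K L : fieldType) (phi : {rmorphism K -> L}).
Variables (A : falgType K) (B C : falgType L).
Variables (f : {rmorphism A -> C}) (g : {lrmorphism B -> C}).
Hypothesis fZ : forall c a, f (c *: a) = phi c *: f a.
Hypothesis fgC : forall a b, f a * g b = g b * f a.

(** Universal property of the tensor product: the map is fixed on basis tensors, and
    multiplicativity is checked on pure tensors, where it reduces to the commutation of the two
    images. *)
Lemma tens_lift :
  {h : {lrmorphism tensor phi A B -> C} | forall a b, h (tpure phi a b) = f a * g b}.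
Proof.
pose h0 (x : tensor phi A B) : C := \sum_i \sum_j (x : 'M_(_, _)) i j *:
  (f (vbasis {:A})`_i * g (vbasis {:B})`_j).
have hL : linear h0.
  move=> c x y; rewrite /h0 scaler_sumr -big_split; apply: eq_bigr => i _.
  rewrite scaler_sumr -big_split; apply: eq_bigr => j _.
  by rewrite !mxE scalerDl scalerA.
have hP a b : h0 (tpure phi a b) = f a * g b.
  rewrite {2}(coord_vbasis (memvf a)) {2}(coord_vbasis (memvf b)) !rmorph_sum /=.
  rewrite mulr_suml; apply: eq_bigr => i _; rewrite mulr_sumr.
  apply: eq_bigr => j _.
  by rewrite !mxE fZ linearZ -scalerAl -scalerAr scalerA.
have hD x y : h0 (x + y) = h0 x + h0 y by have := hL 1 x y; rewrite !scale1r.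
have h00 : h0 0 = 0 by apply: (addrI (h0 0)); rewrite -hD !addr0.
have hZ c x : h0 (c *: x) = c *: h0 x by rewrite -[c *: x]addr0 hL h00 addr0.
have hM : monoid_morphism h0.
  split; first by rewrite -tpure1 hP !rmorph1 mul1r.
  elim/tensor_ind => [|x x' IHx IHx'|c a b] y.
  - by rewrite mul0r h00 mul0r.
  - by rewrite mulrDl !hD mulrDl IHx IHx'.
  elim/tensor_ind: y => [|y y' IHy IHy'|c' a' b'].
  - by rewrite mulr0 h00 mulr0.
  - by rewrite mulrDr !hD mulrDr IHy IHy'.
  rewrite -!(scalerAl, scalerAr) tpureM !hZ !hP -!(scalerAl, scalerAr) !rmorphM.
  by rewrite !mulrA -[f a * g b * _]mulrA -fgC !mulrA.
by have [h hE] := lrmorphism_of hL hM; exists h => a b; rewrite hE.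
Qed.

End TensorLift.

Section TensorMaps.
Variables (K L : fieldType) (phi : {rmorphism K -> L}).

Lemma tensor_gen (A : falgType K) (B C : falgType L)
    (h : {lrmorphism C -> tensor phi A B}) :
  (forall a, exists x, h x = tpure phi a 1) ->
  (forall b, exists x, h x = tpure phi 1 b) -> forall y, exists x, h x = y.
Proof.
move=> h1 h2; elim/tensor_ind => [|x y [x' <-] [y' <-]|c a b].
- by exists 0; rewrite raddf0.
- by exists (x' + y'); rewrite raddfD.
have [x xE] := h1 a; have [y yE] := h2 b.
by exists (c *: (x * y)); rewrite linearZ rmorphM /= xE yE tpureM mul1r mulr1.
Qed.

Definition tinl (A : falgType K) (B : falgType L) (a : A) : tensor phi A B :=
  tpure phi a 1.
Definition tinr (A : falgType K) (B : falgType L) (b : B) : tensor phi A B :=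
  tpure phi 1 b.

Variables (A : falgType K) (B : falgType L).

Lemma tinl_is_zmod_morphism : zmod_morphism (@tinl A B).
Proof.
by move=> x y; rewrite /tinl -scaleN1r tpureDl tpureZl rmorphN1 scaleN1r.
Qed.

Lemma tinl_is_monoid_morphism : monoid_morphism (@tinl A B).
Proof. by split=> [|x y]; rewrite /tinl ?tpure1 // tpureM mulr1. Qed.

Lemma tinr_is_linear : linear (@tinr A B).
Proof. by move=> c x y; rewrite /tinr tpureDr tpureZr. Qed.

Lemma tinr_is_monoid_morphism : monoid_morphism (@tinr A B).
Proof. by split=> [|x y]; rewrite /tinr ?tpure1 // tpureM mulr1. Qed.

HB.instance Definition _ :=
  GRing.isZmodMorphism.Build _ _ (@tinl A B) tinl_is_zmod_morphism.
HB.instance Definition _ :=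
  GRing.isMonoidMorphism.Build _ _ (@tinl A B) tinl_is_monoid_morphism.
HB.instance Definition _ :=
  GRing.isLinear.Build L B (tensor phi A B) *:%R (@tinr A B) tinr_is_linear.
HB.instance Definition _ :=
  GRing.isMonoidMorphism.Build _ _ (@tinr A B) tinr_is_monoid_morphism.

Lemma tinlZ c (a : A) : tinl B (c *: a) = phi c *: tinl B a.
Proof. exact: tpureZl. Qed.

Lemma tinlr (a : A) (b : B) : tinl B a * tinr A b = tpure phi a b.
Proof. by rewrite tpureM mul1r mulr1. Qed.

Lemma tinrl (a : A) (b : B) : tinr A b * tinl B a = tpure phi a b.
Proof. by rewrite tpureM mul1r mulr1. Qed.

End TensorMaps.

Section TensAlg.
Variable K : fieldType.
Implicit Types A B C : falgType K.
Local Notation id_K := (idfun : {rmorphism K -> K}).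

HB.instance Definition _ A B := GRing.isScalable.Build K A (tensor id_K A B) *:%R
  (@tinl _ _ id_K A B) (@tinlZ _ _ id_K A B).

Lemma alg_isom_refl A : alg_isom A A.
Proof. by exists idfun; exists id. Qed.

Lemma alg_isom_sym A B : alg_isom A B -> alg_isom B A.
Proof.
case=> h [g hK gK].
have gL : linear g by move=> c x y; apply: (can_inj hK); rewrite linearP /= !gK.
have gM : monoid_morphism g.
  by split=> [|x y]; apply: (can_inj hK); rewrite ?rmorph1 ?rmorphM /= !gK.
have [g' gE] := lrmorphism_of gL gM.
by exists g'; exists h => x; rewrite gE ?gK ?hK.
Qed.

Lemma alg_isom_trans A B C : alg_isom A B -> alg_isom B C -> alg_isom A C.
Proof. by case=> h hb [g gb]; exists (g \o h); apply: bij_comp. Qed.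

Lemma alg_isom_dim A B : alg_isom A B -> \dim {:B} = \dim {:A}.
Proof.
case=> u [v uK vK].
have k0 : lker (linfun u) == 0%VS.
  by apply/lker0P=> x y; rewrite !lfunE; apply: (can_inj uK).
have -> : {:B}%VS = limg (linfun u).
  by apply/vspaceP=> y; rewrite memvf -[y]vK -(lfunE u) memv_img ?memvf.
by rewrite limg_dim_eq // (eqP k0) capv0.
Qed.

Lemma tensalg_lift A B C (f : {lrmorphism A -> C}) (g : {lrmorphism B -> C}) :
  (forall a b, f a * g b = g b * f a) ->
  {h : {lrmorphism tensalg A B -> C} |
    forall a b, h (tpure id_K a b) = f a * g b}.
Proof.
by move=> fgC; apply: (@tens_lift _ _ id_K _ _ _ f g) => //; exact: (linearZZ f).
Qed.

(** Equal dimensions reduce bijectivity to surjectivity. Surjectivity is asked of any [h] with the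
    prescribed values on the two factors, since the lifted map is known only through those
    values. *)
Lemma tensalg_isom A B C (f : {lrmorphism A -> C}) (g : {lrmorphism B -> C}) :
  (forall a b, f a * g b = g b * f a) -> \dim {:C} = (\dim {:A} * \dim {:B})%N ->
  (forall h : {lrmorphism tensalg A B -> C},
     (forall a, h (tpure id_K a 1) = f a) -> (forall b, h (tpure id_K 1 b) = g b) ->
     forall y, exists x, h x = y) ->
  alg_isom (tensalg A B) C.
Proof.
move=> fgC dC hS; have [h hE] := tensalg_lift fgC.
exists h; apply: surj_bij; first by rewrite dim_tensor dC.
by apply: hS => [a|b]; rewrite hE rmorph1 ?mulr1 ?mul1r.
Qed.

Lemma tensalgC A B : alg_isom (tensalg A B) (tensalg B A).
Proof.
pose f : {lrmorphism A -> tensalg B A} := @tinr _ _ id_K B A.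
pose g : {lrmorphism B -> tensalg B A} := @tinl _ _ id_K B A.
apply: (@tensalg_isom _ _ _ f g) => [a b||h hf hg].
- by rewrite /f /g /= tinlr tinrl.
- by rewrite dim_tensor mulnC.
apply: tensor_gen => a; first by exists (tpure id_K 1 a); rewrite hg.
by exists (tpure id_K a 1); rewrite hf.
Qed.

Lemma tensalg_isom2 A A' B B' :
  alg_isom A A' -> alg_isom B B' -> alg_isom (tensalg A B) (tensalg A' B').
Proof.
case=> f bf [g bg]; have dA := alg_isom_dim (ex_intro _ f bf).
have dB := alg_isom_dim (ex_intro _ g bg).
pose f' : {lrmorphism A -> tensalg A' B'} := @tinl _ _ id_K A' B' \o f.
pose g' : {lrmorphism B -> tensalg A' B'} := @tinr _ _ id_K A' B' \o g.
apply: (@tensalg_isom _ _ _ f' g') => [a b||h hf hg].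
- by rewrite /f' /g' /= tinlr tinrl.
- by rewrite dim_tensor dA dB.
have [f1 _ f1K] := bf; have [g1 _ g1K] := bg.
apply: tensor_gen => a.
  by exists (tpure id_K (f1 a) 1); rewrite hf /f' /= f1K.
by exists (tpure id_K 1 (g1 a)); rewrite hg /g' /= g1K.
Qed.

Lemma tensalgA A B C : alg_isom (tensalg (tensalg A B) C) (tensalg A (tensalg B C)).
Proof.
pose f1 : {lrmorphism A -> tensalg A (tensalg B C)} := @tinl _ _ id_K A (tensalg B C).
pose r : {lrmorphism tensalg B C -> tensalg A (tensalg B C)} :=
  @tinr _ _ id_K A (tensalg B C).
pose f2 : {lrmorphism B -> tensalg A (tensalg B C)} := r \o @tinl _ _ id_K B C.
pose g : {lrmorphism C -> tensalg A (tensalg B C)} := r \o @tinr _ _ id_K B C.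
have f12 a b : f1 a * f2 b = f2 b * f1 a by rewrite /f1 /f2 /r /= tinlr tinrl.
have [f fE] := tensalg_lift f12.
have fl a : f (tpure id_K a 1) = tpure id_K a 1 by rewrite fE rmorph1 mulr1.
have fr b : f (tpure id_K 1 b) = tpure id_K 1 (tpure id_K b 1).
  by rewrite fE rmorph1 mul1r.
apply: (@tensalg_isom _ _ _ f g) => [x c||h hf hg].
- elim/tensor_ind: x => [|x y IHx IHy|k a b]; first by rewrite raddf0 mul0r mulr0.
    by rewrite raddfD mulrDl mulrDr IHx IHy.
  rewrite linearZ /= fE -scalerAl -scalerAr; congr (_ *: _).
  rewrite /f1 /f2 /g /r /=.
  by rewrite !tpureM !(mul1r, mulr1).
- by rewrite !dim_tensor mulnA.
apply: tensor_gen => [a|].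
  by exists (tpure id_K (tpure id_K a 1) 1); rewrite hf fl.
elim/tensor_ind => [|x y [x' x'E] [y' y'E]|k b c].
- by exists 0; rewrite raddf0 tpure0r.
- by exists (x' + y'); rewrite raddfD tpureDr /= x'E y'E.
exists (k *: (tpure id_K (tpure id_K 1 b) 1 * tpure id_K 1 c)).
rewrite linearZ rmorphM /= hf hg fr /g /r /= !tpureZr; congr (_ *: _).
by rewrite /tinr !tpureM !(mul1r, mulr1).
Qed.

Lemma tensalg1l A : alg_isom (tensalg K^o A) A.
Proof.
have [f fE] : {f : {lrmorphism K^o -> A} | f =1 in_alg A}.
  apply: lrmorphism_of => [c x y|]; first by rewrite /= scalerDl scalerA.
  by split=> [|x y]; rewrite /= ?scale1r // -scalerAl mul1r scalerA.
apply: (@tensalg_isom _ _ _ f idfun) => [a b||h hf hg y].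
- by rewrite fE /= -scalerAl -scalerAr mul1r mulr1.
- by rewrite regular_fullv dimv1 mul1n.
by exists (tpure id_K 1 y); rewrite hg.
Qed.

Lemma tensalg1r A : alg_isom (tensalg A K^o) A.
Proof. exact: alg_isom_trans (tensalgC _ _) (tensalg1l _). Qed.

End TensAlg.

(** * Brauer equivalence *)

Section Brauer.
Variable K : fieldType.
Implicit Types A B C D : falgType K.
Local Notation id_K := (idfun : {rmorphism K -> K}).

Lemma mxtens_index_eq m n (u v : 'I_m * 'I_n) :
  (mxtens_index u == mxtens_index v) = (u == v).
Proof. exact: (can_eq (@mxtens_indexK m n)). Qed.

Lemma tensmx_delta m n p q (i : 'I_m) (j : 'I_n) (k : 'I_p) (l : 'I_q) :
  delta_mx i j *t delta_mx k l =
  delta_mx (mxtens_index (i, k)) (mxtens_index (j, l)) :> 'M[K]_(_, _).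
Proof.
apply/matrixP=> x y; case: (mxtens_indexP x) => i' k'; case: (mxtens_indexP y) => j' l'.
rewrite tensmxE !mxE !mxtens_index_eq !xpair_eqE -natrM mulnb.
by rewrite andbACA.
Qed.

Lemma tensmx11 m n : (1%:M : 'M[K]_m) *t (1%:M : 'M_n) = 1%:M.
Proof.
apply/matrixP=> x y; case: (mxtens_indexP x) => i k; case: (mxtens_indexP y) => j l.
by rewrite tensmxE !mxE mxtens_index_eq xpair_eqE -natrM mulnb.
Qed.

Lemma tensalg_mx r s :
  exists t, alg_isom (tensalg 'M[K]_r.+1 'M[K]_s.+1) 'M[K]_t.+1.
Proof.
(* The successor of this number is the product of r + 1 and s + 1, the size of a Kronecker
   product. *)
exists (s + r * s.+1)%N; pose R : falgType K := 'M[K]_((s + r * s.+1).+1).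
have mulE (a c : 'M[K]_r.+1) (b d : 'M[K]_s.+1) :
    (a *t b : R) * (c *t d : R) = (a *m c) *t (b *m d).
  exact: (@tensmx_mul K r.+1 r.+1 s.+1 s.+1 r.+1 s.+1 a b c d).
have [f fE] : {f : {lrmorphism 'M[K]_r.+1 -> R} | f =1 fun M => M *t (1%:M : 'M_s.+1)}.
  apply: lrmorphism_of => [c x y|].
    by apply/matrixP=> i j; rewrite !mxE mulrDl mulrA.
  split=> [|x y]; first exact: (tensmx11 r.+1 s.+1).
  by rewrite -[X in x * y *t X]mulmx1; apply/esym/mulE.
have [g gE] : {g : {lrmorphism 'M[K]_s.+1 -> R} | g =1 fun M => (1%:M : 'M_r.+1) *t M}.
  apply: lrmorphism_of => [c x y|].
    by apply/matrixP=> i j; rewrite !mxE mulrDr mulrCA.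
  split=> [|x y]; first exact: (tensmx11 r.+1 s.+1).
  by rewrite -[X in X *t (x * y)]mulmx1; apply/esym/mulE.
have fgE a b : f a * g b = a *t b.
  by rewrite fE gE; apply: etrans (mulE _ _ _ _) _; rewrite mul1mx mulmx1.
apply: (@tensalg_isom _ _ _ _ f g) => [a b||h hf hg y].
- rewrite fgE fE gE; apply: esym; apply: etrans (mulE _ _ _ _) _.
  by rewrite mul1mx mulmx1.
- by rewrite !dimvf /dim /=; lia.
rewrite [y]matrix_sum_delta; elim/big_ind: _ => [|a b [a' <-] [b' <-]|i _].
- by exists 0; rewrite raddf0.
- by exists (a' + b'); rewrite raddfD.
elim/big_ind: _ => [|a b [a' <-] [b' <-]|j _].
- by exists 0; rewrite raddf0.
- by exists (a' + b'); rewrite raddfD.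
case: (@mxtens_indexP r.+1 s.+1 i) => i' k; case: (@mxtens_indexP r.+1 s.+1 j) => j' l.
exists (y (mxtens_index (i', k)) (mxtens_index (j', l)) *:
  (tpure id_K (delta_mx i' j') 1 * tpure id_K 1 (delta_mx k l))).
by rewrite linearZ rmorphM /= hf hg fgE tensmx_delta.
Qed.

Lemma isom_brauer A B : alg_isom A B -> brauer_equiv A B.
Proof.
by move=> AB; exists 0, 0; apply: tensalg_isom2 => //; apply: alg_isom_refl.
Qed.

Lemma brauer_refl A : brauer_equiv A A.
Proof. exact: isom_brauer (alg_isom_refl A). Qed.

Lemma brauer_sym A B : brauer_equiv A B -> brauer_equiv B A.
Proof. by case=> r [s /alg_isom_sym]; exists s, r. Qed.

Lemma tensalg_swap A B C : alg_isom (tensalg (tensalg A B) C) (tensalg (tensalg A C) B).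
Proof.
apply: alg_isom_trans (tensalgA _ _ _) _.
apply: alg_isom_trans (alg_isom_sym (tensalgA _ _ _)).
exact: tensalg_isom2 (alg_isom_refl _) (tensalgC _ _).
Qed.

(** No cancellation is required: tensor the first isomorphism with the matrix factor that B carries
    in the second, swap the two matrix factors of B, then apply the second isomorphism. *)
Lemma brauer_trans B A C : brauer_equiv A B -> brauer_equiv B C -> brauer_equiv A C.
Proof.
move=> [r [s AB]] [t [u BC]].
have [p rt] := tensalg_mx r t; have [q us] := tensalg_mx u s.
exists p, q.
apply: alg_isom_trans (tensalg_isom2 (alg_isom_refl A) (alg_isom_sym rt)) _.
apply: alg_isom_trans (tensalg_isom2 (alg_isom_refl C) us).
apply: alg_isom_trans (alg_isom_sym (tensalgA _ _ _)) _.
apply: alg_isom_trans (tensalgA _ _ _).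
apply: alg_isom_trans (tensalg_isom2 AB (alg_isom_refl _)) _.
apply: alg_isom_trans (tensalg_isom2 BC (alg_isom_refl _)).
exact: tensalg_swap.
Qed.

Lemma brauer_tens A A' B B' : brauer_equiv A A' -> brauer_equiv B B' ->
  brauer_equiv (tensalg A B) (tensalg A' B').
Proof.
suff tl C D E : brauer_equiv C D -> brauer_equiv (tensalg C E) (tensalg D E).
  move=> AA' BB'; apply: brauer_trans (tl _ _ B AA') _.
  apply: brauer_trans (isom_brauer (tensalgC _ _)) _.
  by apply: brauer_trans (tl _ _ _ BB') (isom_brauer (tensalgC _ _)).
case=> r [s CD]; exists r, s.
apply: alg_isom_trans (tensalg_swap _ _ _) _.
apply: alg_isom_trans (tensalg_isom2 CD (alg_isom_refl _)) _.
exact: tensalg_swap.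
Qed.

Lemma mx_brauer_trivial r : brauer_trivial 'M[K]_r.+1.
Proof.
exists 0, r; apply: alg_isom_trans (alg_isom_sym (tensalgC _ _)).
apply: tensalg_isom2 (alg_isom_refl _) _.
have [f fE] : {f : {lrmorphism K^o -> 'M[K]_1} | f =1 fun c => c%:M}.
  apply: lrmorphism_of => [c x y|]; first by rewrite raddfD scale_scalar_mx.
  by split=> [|x y] //; rewrite /= scalar_mxM.
apply: alg_isom_sym; exists f; apply: inj_bij; first by rewrite !dimvf.
by move=> x y /=; rewrite !fE => /matrixP/(_ 0 0); rewrite !mxE eqxx.
Qed.

Lemma brauer_trivial_tensl A B : brauer_trivial A -> brauer_equiv (tensalg A B) B.
Proof.
move=> A1; apply: brauer_trans (brauer_tens A1 (brauer_refl B)) _.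
exact/isom_brauer/tensalg1l.
Qed.

Lemma brauer_trivial_tensr A B : brauer_trivial B -> brauer_equiv (tensalg A B) A.
Proof.
move=> B1; apply: brauer_trans (isom_brauer (tensalgC _ _)) _.
exact: brauer_trivial_tensl.
Qed.

End Brauer.

(** * Extension of scalars *)

Section ScalarExt.
Variables (K L : fieldType) (phi : {rmorphism K -> L}).
Implicit Types A B : falgType K.

Lemma dim_scalar_ext A : \dim {:scalar_ext phi A} = \dim {:A}.
Proof. by rewrite dim_tensor regular_fullv dimv1 muln1. Qed.

Lemma scalar_ext_ind A (P : scalar_ext phi A -> Prop) :
  P 0 -> (forall x y, P x -> P y -> P (x + y)) ->
  (forall c a, P (c *: tpure phi a 1)) -> forall x, P x.
Proof.
move=> P0 PD PZ; elim/tensor_ind => // c a b.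
by rewrite -[b]mulr1 tpureZr scalerA.
Qed.

Lemma scalar_ext_lift A (C : falgType L) (f : {rmorphism A -> C}) :
  (forall c a, f (c *: a) = phi c *: f a) ->
  {h : {lrmorphism scalar_ext phi A -> C} | forall a, h (tpure phi a 1) = f a}.
Proof.
move=> fZ.
have [g gE] : {g : {lrmorphism L^o -> C} | g =1 in_alg C}.
  apply: lrmorphism_of => [c x y|]; first by rewrite /= scalerDl scalerA.
  by split=> [|x y]; rewrite /= ?scale1r // -scalerAl mul1r scalerA.
have fgC a b : f a * g b = g b * f a.
  by rewrite gE /= -scalerAl -scalerAr mul1r mulr1.
have [h hE] := tens_lift fZ fgC.
by exists h => a; rewrite hE rmorph1 mulr1.
Qed.

Lemma scalar_ext_isom_of A (C : falgType L) (f : {rmorphism A -> C}) :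
  (forall c a, f (c *: a) = phi c *: f a) -> \dim {:C} = \dim {:A} ->
  (forall h : {lrmorphism scalar_ext phi A -> C},
     (forall a, h (tpure phi a 1) = f a) -> forall y, exists x, h x = y) ->
  alg_isom (scalar_ext phi A) C.
Proof.
move=> fZ dC hS; have [h hE] := scalar_ext_lift fZ.
by exists h; apply: surj_bij; [rewrite dim_scalar_ext dC | apply: hS].
Qed.

Lemma scalar_ext_isom A B : alg_isom A B ->
  alg_isom (scalar_ext phi A) (scalar_ext phi B).
Proof.
case=> u ub; have [v uK vK] := ub.
pose f : {rmorphism A -> scalar_ext phi B} := @tinl _ _ phi B L^o \o u.
have fZ c a : f (c *: a) = phi c *: f a by rewrite /f /= linearZ /= tinlZ.
apply: (scalar_ext_isom_of fZ) => [|h hE].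
  by rewrite dim_scalar_ext (alg_isom_dim (ex_intro _ u ub)).
elim/scalar_ext_ind => [|x y [x' <-] [y' <-]|c a].
- by exists 0; rewrite raddf0.
- by exists (x' + y'); rewrite raddfD.
by exists (c *: tpure phi (v a) 1); rewrite linearZ /= hE /f /= vK.
Qed.

Lemma scalar_ext_tens A B : alg_isom (scalar_ext phi (tensalg A B))
  (tensalg (scalar_ext phi A) (scalar_ext phi B)).
Proof.
pose C := tensalg A B; pose D := scalar_ext phi C.
pose i : {rmorphism C -> D} := @tinl _ _ phi C L^o.
pose f1 : {rmorphism A -> D} := i \o @tinl _ _ idfun A B.
pose g1 : {rmorphism B -> D} := i \o @tinr _ _ idfun A B.
have f1Z c a : f1 (c *: a) = phi c *: f1 a by rewrite /f1 /= !tinlZ.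
have g1Z c a : g1 (c *: a) = phi c *: g1 a by rewrite /g1 /= linearZ /= tinlZ.
have [f fE] := scalar_ext_lift f1Z; have [g gE] := scalar_ext_lift g1Z.
apply: alg_isom_sym; apply: (@tensalg_isom _ _ _ _ f g) => [x y||h hf hg].
- elim/scalar_ext_ind: x => [|x x' IHx IHx'|c a].
  + by rewrite raddf0 mulr0 mul0r.
  + by rewrite raddfD mulrDl mulrDr IHx IHx'.
  elim/scalar_ext_ind: y => [|y y' IHy IHy'|c' b].
  + by rewrite raddf0 mulr0 mul0r.
  + by rewrite raddfD mulrDl mulrDr IHy IHy'.
  rewrite !linearZ /= -!(scalerAl, scalerAr) fE gE /f1 /g1 /= -!rmorphM tinlr tinrl.
  by rewrite !scalerA mulrC.
- by rewrite !dim_scalar_ext dim_tensor.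
have hP a b : h (tpure idfun (tpure phi a 1) (tpure phi b 1)) = i (tpure idfun a b).
  by rewrite -tinlr rmorphM /= hf hg fE gE /f1 /g1 /= -rmorphM tinlr.
elim/scalar_ext_ind => [|x y [x' <-] [y' <-]|c].
- by exists 0; rewrite raddf0.
- by exists (x' + y'); rewrite raddfD.
elim/tensor_ind => [|x y [x' x'E] [y' y'E]|k a b].
- by exists 0; rewrite raddf0 tpure0l scaler0.
- by exists (x' + y'); rewrite raddfD tpureDl scalerDr /= x'E y'E.
exists (c *: (phi k *: tpure idfun (tpure phi a 1) (tpure phi b 1))).
by rewrite !linearZ /= hP -tinlZ.
Qed.

Lemma scalar_ext_mx r : alg_isom (scalar_ext phi 'M[K]_r.+1) 'M[L]_r.+1.
Proof.
pose f : {rmorphism 'M[K]_r.+1 -> 'M[L]_r.+1} := map_mx phi.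
have fZ c a : f (c *: a) = phi c *: f a by rewrite /f /= map_mxZ.
apply: (scalar_ext_isom_of fZ) => [|h hE y]; first by rewrite !dimvf.
exists (\sum_i \sum_j y i j *: tpure phi (delta_mx i j) 1).
rewrite [RHS]matrix_sum_delta raddf_sum; apply: eq_bigr => i _ /=.
rewrite raddf_sum; apply: eq_bigr => j _ /=.
by rewrite linearZ /= hE /f /= map_delta_mx.
Qed.

Lemma scalar_ext1 : alg_isom (scalar_ext phi K^o) L^o.
Proof.
pose f : {rmorphism K^o -> L^o} := phi.
have fZ c (a : K^o) : f (c *: a) = phi c *: f a by rewrite /f /= rmorphM.
apply: (scalar_ext_isom_of fZ) => [|h hE y]; first by rewrite !dimvf.
by exists (y *: tpure phi 1 1); rewrite linearZ /= hE rmorph1 [LHS]mulr1.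
Qed.

Lemma scalar_ext_brauer A B : brauer_equiv A B ->
  brauer_equiv (scalar_ext phi A) (scalar_ext phi B).
Proof.
suff SE r C : alg_isom (tensalg (scalar_ext phi C) 'M[L]_r.+1)
                       (scalar_ext phi (tensalg C 'M[K]_r.+1)).
  case=> r [s AB]; exists r, s.
  apply: alg_isom_trans (SE _ _) _; apply: alg_isom_trans (alg_isom_sym (SE _ _)).
  exact: scalar_ext_isom.
apply: alg_isom_trans (alg_isom_sym (scalar_ext_tens _ _)).
apply: tensalg_isom2 (alg_isom_refl _) _.
exact/alg_isom_sym/scalar_ext_mx.
Qed.

End ScalarExt.

(** * The quaternion algebra [a, b) *)

(* (x, y, z, t) stands for x + y i + z j + t i j, where i^2 = i + a, j^2 = b    *)
(* and j i = (1 - i) j; with these signs the ring axioms hold in any            *)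
(* characteristic.                                                              *)
Definition quat (K : fieldType) (a b : K) : Type := (K^o * K^o * K^o * K^o)%type.

HB.instance Definition _ (K : fieldType) (a b : K) :=
  Vector.copy (quat a b) (K^o * K^o * K^o * K^o)%type.

(* Locked, as QuatD and QuatZ would otherwise match arbitrary sums in quat a b  *)
HB.lock Definition Quat (K : fieldType) (a b x y z t : K) : quat a b := (x, y, z, t).
Canonical Quat_unlockable := Unlockable Quat.unlock.

Section QuatAlgebra.
Variables (K : fieldType) (a b : K).
Local Notation H := (quat a b).
Local Notation Q := (@Quat K a b).

Lemma QuatP (P : H -> Prop) : (forall x y z t, P (Q x y z t)) -> forall u, P u.
Proof. by move=> PQ [[[x y] z] t]; have := PQ x y z t; rewrite unlock. Qed.

Lemma QuatD x y z t x' y' z' t' :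
  Q x y z t + Q x' y' z' t' = Q (x + x') (y + y') (z + z') (t + t').
Proof. by rewrite unlock. Qed.

Lemma QuatZ c x y z t : c *: Q x y z t = Q (c * x) (c * y) (c * z) (c * t).
Proof. by rewrite unlock. Qed.

Definition qmul (u v : H) : H :=
  let: (x, y, z, t) := u in let: (x', y', z', t') := v in
  Q (x * x' + a * (y * y') + b * (z * (z' + t') - a * (t * t')))
    (x * y' + y * x' + y * y' + b * (t * z' - z * t'))
    (x * z' + a * (y * t') + z * (x' + y') - a * (t * y'))
    (x * t' + y * z' + y * t' + t * x' - z * y').

Lemma qmulE x y z t x' y' z' t' : qmul (Q x y z t) (Q x' y' z' t') =
  Q (x * x' + a * (y * y') + b * (z * (z' + t') - a * (t * t')))
    (x * y' + y * x' + y * y' + b * (t * z' - z * t'))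
    (x * z' + a * (y * t') + z * (x' + y') - a * (t * y'))
    (x * t' + y * z' + y * t' + t * x' - z * y').
Proof. by rewrite /qmul unlock. Qed.

Lemma qmulA : associative qmul.
Proof.
elim/QuatP=> x y z t; elim/QuatP=> x' y' z' t'; elim/QuatP=> x2 y2 z2 t2.
by rewrite !qmulE; congr (Quat _ _ _ _ _ _); ring.
Qed.

Lemma qmul1l : left_id (Q 1 0 0 0) qmul.
Proof. by elim/QuatP=> x y z t; rewrite qmulE; congr (Quat _ _ _ _ _ _); ring. Qed.

Lemma qmul1r : right_id (Q 1 0 0 0) qmul.
Proof. by elim/QuatP=> x y z t; rewrite qmulE; congr (Quat _ _ _ _ _ _); ring. Qed.

Lemma qmulDl : left_distributive qmul +%R.
Proof.
elim/QuatP=> x y z t; elim/QuatP=> x' y' z' t'; elim/QuatP=> x2 y2 z2 t2.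
by rewrite !(qmulE, QuatD); congr (Quat _ _ _ _ _ _); ring.
Qed.

Lemma qmulDr : right_distributive qmul +%R.
Proof.
elim/QuatP=> x y z t; elim/QuatP=> x' y' z' t'; elim/QuatP=> x2 y2 z2 t2.
by rewrite !(qmulE, QuatD); congr (Quat _ _ _ _ _ _); ring.
Qed.

Lemma qone_neq0 : Q 1 0 0 0 != 0.
Proof. by rewrite unlock; apply/eqP=> -[/eqP]; rewrite oner_eq0. Qed.

Lemma qmulZl c u v : c *: qmul u v = qmul (c *: u) v.
Proof.
elim/QuatP: u => x y z t; elim/QuatP: v => x' y' z' t'.
by rewrite !(qmulE, QuatZ); congr (Quat _ _ _ _ _ _); ring.
Qed.

Lemma qmulZr c u v : c *: qmul u v = qmul u (c *: v).
Proof.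
elim/QuatP: u => x y z t; elim/QuatP: v => x' y' z' t'.
by rewrite !(qmulE, QuatZ); congr (Quat _ _ _ _ _ _); ring.
Qed.

HB.instance Definition _ := GRing.Zmodule_isNzRing.Build H
  qmulA qmul1l qmul1r qmulDl qmulDr qone_neq0.
HB.instance Definition _ := GRing.Lmodule_isLalgebra.Build K H qmulZl.
HB.instance Definition _ := GRing.Lalgebra_isAlgebra.Build K H qmulZr.
HB.instance Definition _ := Algebra_isFalgebra.Build K H.

Lemma QuatM x y z t x' y' z' t' : Q x y z t * Q x' y' z' t' =
  Q (x * x' + a * (y * y') + b * (z * (z' + t') - a * (t * t')))
    (x * y' + y * x' + y * y' + b * (t * z' - z * t'))
    (x * z' + a * (y * t') + z * (x' + y') - a * (t * y'))
    (x * t' + y * z' + y * t' + t * x' - z * y').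
Proof. exact: qmulE. Qed.

Lemma Quat1 : 1 = Q 1 0 0 0. Proof. by []. Qed.

Lemma dim_quat : \dim {:H} = 4%N. Proof. by rewrite dimvf. Qed.

Definition qi : H := Q 0 1 0 0.
Definition qj : H := Q 0 0 1 0.

Lemma QuatE x y z t : Q x y z t = x%:A + y *: qi + z *: qj + t *: (qi * qj).
Proof.
rewrite /qi /qj Quat1 !QuatM ?QuatZ ?QuatD.
by congr (Quat _ _ _ _ _ _); ring.
Qed.

Lemma qii : qi * qi = qi + a%:A.
Proof. by rewrite /qi Quat1 !QuatM ?QuatZ ?QuatD; congr (Quat _ _ _ _ _ _); ring. Qed.

Lemma qjj : qj * qj = b%:A.
Proof. by rewrite /qj Quat1 !QuatM ?QuatZ ?QuatD; congr (Quat _ _ _ _ _ _); ring. Qed.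

Lemma qji : qj * qi = qj - qi * qj.
Proof.
rewrite /qi /qj -scaleN1r !QuatM ?QuatZ ?QuatD.
by congr (Quat _ _ _ _ _ _); ring.
Qed.

Section Lift.
Variables (C : falgType K) (I J : C).
Hypotheses (II : I * I = I + a%:A) (JJ : J * J = b%:A) (JI : J * I = J - I * J).

(** Universal property of [a, b): any pair satisfying the defining relations in an algebra C
    receives i and j. *)
Lemma quat_lift : {h : {lrmorphism H -> C} | h qi = I /\ h qj = J}.
Proof.
(* The [U x y] form a commutative subalgebra containing I, and J moves past it by the conjugation I
   -> 1 - I. The lift sends x + y i + z j + t i j to U x y + U z t J, so multiplicativity follows
   from the rules for sums and products of the [U x y], the rule for J, and J^2 = b. *)
pose U x y : C := x%:A + y *: I.
have UD x y x' y' : U x y + U x' y' = U (x + x') (y + y').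
  by rewrite /U !scalerDl addrACA.
have UZ c x y : c *: U x y = U (c * x) (c * y).
  by rewrite /U scalerDr !scalerA.
have IU x y : I * U x y = U (a * y) (x + y).
    rewrite /U mulrDr -!scalerAr mulr1 II scalerDr scalerA [y * a]mulrC scalerDl.
    by rewrite addrA addrC.
have UM x y x' y' :
    U x y * U x' y' = U (x * x' + a * (y * y')) (x * y' + y * x' + y * y').
  rewrite {1}/U mulrDl -!scalerAl mul1r IU !UZ UD.
  by congr (U _ _); ring.
have JU x y : J * U x y = U (x + y) (- y) * J.
  rewrite /U mulrDr mulrDl -!(scalerAl, scalerAr) JI mulr1 mul1r scalerDl scalerBr.
  by rewrite scaleNr addrA.
have U00 : U 0 0 = 0 by rewrite /U !scale0r addr0.
have U10 : U 1 0 = 1 by rewrite /U scale0r scale1r addr0.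
have U01 : U 0 1 = I by rewrite /U scale0r scale1r add0r.
clearbody U.
pose h0 (u : H) : C := let: (x, y, z, t) := u in U x y + U z t * J.
have h0E x y z t : h0 (Q x y z t) = U x y + U z t * J by rewrite unlock.
have hL : linear h0.
  move=> c; elim/QuatP=> x y z t; elim/QuatP=> x' y' z' t'.
  by rewrite QuatZ QuatD !h0E -!(UD, UZ) mulrDl -scalerAl addrACA -scalerDr.
have hM : monoid_morphism h0.
  split; first by rewrite Quat1 h0E U10 U00 mul0r addr0.
  elim/QuatP=> x y z t; elim/QuatP=> x' y' z' t'.
  rewrite QuatM !h0E mulrDl !mulrDr.
  have -> : U x y * (U z' t' * J) = U x y * U z' t' * J by rewrite mulrA.
  have -> : U z t * J * U x' y' = U z t * U (x' + y') (- y') * J.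
    by rewrite -mulrA JU mulrA.
  have -> : U z t * J * (U z' t' * J) = U z t * U (b * (z' + t')) (b * - t').
    rewrite -UZ -scalerAr mulrA -[_ * J * U _ _]mulrA JU -!mulrA JJ.
    by rewrite -scalerAr !mulr1 -scalerAr.
  rewrite !UM [X in _ = _ + X]addrC [RHS]addrACA -mulrDl !UD.
  by congr (U _ _ + U _ _ * J); ring.
have [h hE] := lrmorphism_of hL hM; exists h.
by rewrite !hE !h0E U00 U01 U10 mul0r mul1r addr0 add0r.
Qed.

End Lift.

End QuatAlgebra.

Lemma Quat_inj (K : fieldType) (a b x y z t x' y' z' t' : K) :
  Quat a b x y z t = Quat a b x' y' z' t' -> [/\ x = x', y = y', z = z' & t = t'].
Proof. by rewrite unlock => -[-> -> -> ->]. Qed.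

Lemma Quat0 (K : fieldType) (a b : K) : 0 = Quat a b 0 0 0 0.
Proof. by rewrite unlock. Qed.

Section QuatChar2.
Variables (K : fieldType) (K2 : 2%N \in [pchar K]).
Implicit Types (A C : falgType K).

(* The witness z absorbs the even terms, which ring and field do not discard.   *)
Lemma char2_eq (z x y : K) : x = y + z *+ 2 -> x = y.
Proof. by rewrite mulr2n (addrr_pchar2 K2) addr0. Qed.

Section Simple.
Variables (a b : K) (b0 : b != 0).
Local Notation Q := (@Quat K a b).

Lemma qi_comm x y z t : qi a b * Q x y z t - Q x y z t * qi a b = Q 0 0 z t.
Proof.
rewrite /qi -scaleN1r !QuatM QuatZ QuatD; congr (Quat _ _ _ _ _ _).
- by ring.
- by ring.
- by apply: (@char2_eq (a * t - z)); ring.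
- by apply: (@char2_eq z); ring.
Qed.

Lemma qj_comm x y z t : qj a b * Q x y z t - Q x y z t * qj a b = Q (b * t) 0 y 0.
Proof.
rewrite /qj -scaleN1r !QuatM QuatZ QuatD; congr (Quat _ _ _ _ _ _).
- by ring.
- by apply: (@char2_eq (- (b * t))); ring.
- by ring.
- by apply: (@char2_eq (- y)); ring.
Qed.

(** For u = x + y i + z j + t i j, the product [i, u] j equals b (z + t i); for v = x + y i, the
    product [j, v] j is the scalar b y. Hence a nonzero ideal contains a nonzero scalar. A predicate
    [P] covers both kernels of morphisms and subspaces. *)
Lemma quat_ideal (P : quat a b -> Prop) :
  (forall u v, P u -> P v -> P (u - v)) ->
  (forall u v, P u -> P (v * u)) -> (forall u v, P u -> P (u * v)) ->
  forall u, u != 0 -> P u -> P 1.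
Proof.
move=> PB Pl Pr u u0 Pu.
have PZ c v : P v -> P (c *: v) by rewrite -mulr_algl; apply: Pl.
have P1 c : c != 0 -> P (Q c 0 0 0) -> P 1.
  move=> c0 /(PZ c^-1); rewrite QuatZ mulVf // !mulr0.
  by rewrite Quat1.
have P2 x y : Q x y 0 0 != 0 -> P (Q x y 0 0) -> P 1.
  move=> xy0 Pxy; have [y0|y0] := eqVneq y 0.
    apply: (@P1 x); last by move: Pxy; rewrite y0.
    by apply: contraNneq xy0 => x0; rewrite x0 y0 -Quat0.
  apply: (@P1 (b * y)); first by rewrite mulf_neq0.
  have := Pr _ (qj a b) (PB _ _ (Pl _ (qj a b) Pxy) (Pr _ (qj a b) Pxy)).
  by rewrite qj_comm /qj QuatM; congr P; congr (Quat _ _ _ _ _ _); ring.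
elim/QuatP: u u0 Pu => x y z t u0 Pu.
have [zt|zt] := eqVneq (Q (b * z) (b * t) 0 0) 0.
  have [z0 t0] : z = 0 /\ t = 0.
    move: zt; rewrite unlock => -[/eqP bz /eqP bt].
    by move: bz bt; rewrite !mulf_eq0 (negPf b0) => /eqP -> /eqP ->.
  by apply: (P2 x y); move: u0 Pu; rewrite z0 t0.
apply: P2 zt _.
have := Pr _ (qj a b) (PB _ _ (Pl _ (qi a b) Pu) (Pr _ (qi a b) Pu)).
by rewrite qi_comm /qj QuatM; congr P; congr (Quat _ _ _ _ _ _); ring.
Qed.

Lemma quat_lrmorphism_inj C (h : {lrmorphism quat a b -> C}) : injective h.
Proof.
apply: raddf_inj => u hu; apply/eqP/negPn/negP=> u0.
have: h 1 = 0.
  apply: (quat_ideal (P := fun u => h u = 0)) u0 hu => v w.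
  - by move=> hv hw; rewrite rmorphB /= hv hw subr0.
  - by move=> hv; rewrite rmorphM /= hv mulr0.
  - by move=> hv; rewrite rmorphM /= hv mul0r.
by rewrite rmorph1 => /eqP; rewrite oner_eq0.
Qed.

Lemma quat_central_simple : central_simple (quat a b).
Proof.
split.
  apply/eqP; rewrite eqEsubv; apply/andP; split; apply/subvP=> u; last first.
    case/vlineP=> c ->; rewrite memv_cap memvf; apply/centvP=> v _.
    by rewrite -scalerAl -scalerAr mul1r mulr1.
  rewrite memv_cap => /andP[_ /centvP uC].
  have ui := uC (qi a b) (memvf _); have uj := uC (qj a b) (memvf _).
  elim/QuatP: u ui uj {uC} => x y z t.
  move=> /esym/eqP; rewrite -subr_eq0 qi_comm => /eqP ui.
  move=> /esym/eqP; rewrite -subr_eq0 qj_comm => /eqP uj.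
  move: ui uj; rewrite Quat0 => /Quat_inj[_ _ -> ->] /Quat_inj[_ _ -> _].
  apply/vlineP; exists x; rewrite Quat1 QuatZ.
  by congr (Quat _ _ _ _ _ _); ring.
move=> I Il Ir; have [->|I0] := eqVneq I 0%VS; [by left | right].
have l u v : u \in I -> v * u \in I.
  by move=> uI; apply: (subvP Il); rewrite memv_mul ?memvf.
have r u v : u \in I -> u * v \in I.
  by move=> uI; apply: (subvP Ir); rewrite memv_mul ?memvf.
have I1 : 1 \in I.
  apply: (quat_ideal (P := fun u => u \in I)) (memv_pick I) => //.
    by move=> u v; apply: memvB.
  by rewrite vpick0.
apply/eqP; rewrite eqEsubv subvf; apply/subvP=> u _.
by rewrite -[u]mulr1 l.
Qed.

Lemma quat_quaternion : quaternion_algebra (quat a b).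
Proof. by split; [apply: quat_central_simple | rewrite dim_quat]. Qed.

(** By simplicity the lift is injective, so in dimension 4 it is enough to exhibit two elements with
    the right relations. *)
Lemma quat_isom C (I J : C) : \dim {:C} = 4%N -> I * I = I + a%:A ->
  J * J = b%:A -> J * I = J - I * J -> alg_isom (quat a b) C.
Proof.
move=> dC II JJ JI; have [h _] := quat_lift II JJ JI.
by exists h; apply: inj_bij (@quat_lrmorphism_inj _ h); rewrite dim_quat dC.
Qed.

End Simple.

(** Replace i by x + i + y j and keep j: as i j + j i = j, the square of the new element is itself
    plus a + x^2 + x + y^2 b. *)
Lemma quat_shift (a b x y : K) : b != 0 ->
  alg_isom (quat (a + x ^+ 2 + x + y ^+ 2 * b) b) (quat a b).
Proof.
move=> b0; apply: (@quat_isom _ _ b0 _ (Quat a b x 1 y 0) (qj a b)).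
- by rewrite dim_quat.
- rewrite Quat1 QuatM QuatZ QuatD; congr (Quat _ _ _ _ _ _).
  + by apply: (@char2_eq (- x)); ring.
  + by apply: (@char2_eq x); ring.
  + by apply: (@char2_eq (x * y)); ring.
  + by ring.
- exact: qjj.
rewrite -scaleN1r !QuatM QuatZ QuatD; congr (Quat _ _ _ _ _ _).
- by apply: (@char2_eq (b * y)); ring.
- by ring.
- by apply: (@char2_eq x); ring.
- by ring.
Qed.

Lemma quat_sqr (a b : K) : b != 0 -> alg_isom (quat (a ^+ 2) b) (quat a b).
Proof.
move=> b0; have := quat_shift a a 0 b0.
by congr (alg_isom (quat _ _) _); apply: (@char2_eq a); ring.
Qed.

(* In quat a (1 + z), the elements j + 1 and i + i j / (1 + z) play the roles   *)
(* of j and i.                                                                  *)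
Lemma quat_slot (a z : K) : z != 0 -> 1 + z != 0 ->
  alg_isom (quat (a * z / (1 + z)) z) (quat a (1 + z)).
Proof.
move=> z0 z1; set b := 1 + z in z1 *.
apply: (@quat_isom _ _ z0 _ (Quat a b 0 1 0 b^-1) (Quat a b 1 0 1 0)).
- by rewrite dim_quat.
- rewrite Quat1 QuatM QuatZ QuatD; congr (Quat _ _ _ _ _ _); rewrite ?/b; by field.
- rewrite Quat1 QuatM QuatZ; congr (Quat _ _ _ _ _ _).
  + by apply: (@char2_eq 1); rewrite /b; ring.
  + by ring.
  + by apply: (@char2_eq 1); ring.
  + by ring.
rewrite -scaleN1r !QuatM QuatZ QuatD; congr (Quat _ _ _ _ _ _).
- by field.
- by apply: (@char2_eq 1); field.
- by field.
- by apply: (@char2_eq b^-1); field.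
Qed.

End QuatChar2.

(** * Splitting and norms *)

Definition mx2 (K : fieldType) (w x y z : K) : 'M[K]_2 :=
  \matrix_(i, j) if i == 0 then (if j == 0 then w else x) else (if j == 0 then y else z).

Lemma mx2P (K : fieldType) (A B : 'M[K]_2) :
  A 0 0 = B 0 0 -> A 0 1 = B 0 1 -> A 1 0 = B 1 0 -> A 1 1 = B 1 1 -> A = B.
Proof.
move=> h1 h2 h3 h4; apply/matrixP=> i j.
have ord2 (k : 'I_2) : k = 0 \/ k = 1.
  by case: k => [[|[|//]] ?]; [left | right]; apply: val_inj.
by case: (ord2 i) => ->; case: (ord2 j) => ->.
Qed.

Section QuatSplit.
Variables (K : fieldType) (K2 : 2%N \in [pchar K]).
Variables (a b : K) (b0 : b != 0).

(** On the basis 1, i of K[i], where i^2 = i + a, the first matrix is multiplication by i; the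
    second is conjugation followed by multiplication by s + t i, whose square is the norm s^2 + s t
    + a t^2 = b. *)
Lemma quat_mx s t : b = s ^+ 2 + s * t + a * t ^+ 2 -> alg_isom (quat a b) 'M[K]_2.
Proof.
move=> bE; apply: (@quat_isom _ K2 _ _ b0 _ (mx2 0 a 1 1) (mx2 s (s + t * a) t (- s))).
- by rewrite dimvf.
- by apply: mx2P; rewrite !mxE !big_ord_recl big_ord0 !mxE /=; ring.
- by rewrite bE; apply: mx2P; rewrite !mxE !big_ord_recl big_ord0 !mxE /=; ring.
apply: mx2P; rewrite !mxE !big_ord_recl !big_ord0 !mxE /=.
- by apply: (char2_eq K2 (z := a * t)); ring.
- by ring.
- by ring.
- by apply: (char2_eq K2 (z := a * t)); ring.
Qed.

(** The second factor is the quaternion conjugate, so the scalar is the reduced norm. *)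
Lemma quat_conj x y z t :
  Quat a b x y z t * Quat a b (x + y) (- y) (- z) (- t) =
  (x ^+ 2 + x * y - a * y ^+ 2 - b * (z ^+ 2 + z * t - a * t ^+ 2))%:A.
Proof. by rewrite Quat1 QuatM QuatZ; congr (Quat _ _ _ _ _ _); ring. Qed.

(** A zero of the reduced norm says N(x + y i) = b N(z + t i), with N the norm of K[i]. If N(z + t
    i) is nonzero, divide. Otherwise N has a nontrivial zero, hence is a hyperbolic plane and
    represents every scalar. *)
Lemma quat_isotropic x y z t : Quat a b x y z t != 0 ->
  x ^+ 2 + x * y - a * y ^+ 2 - b * (z ^+ 2 + z * t - a * t ^+ 2) = 0 ->
  exists s t, b = s ^+ 2 + s * t + a * t ^+ 2.
Proof.
have iso (p q : K) : ~~ ((p == 0) && (q == 0)) -> p ^+ 2 + p * q - a * q ^+ 2 = 0 ->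
    exists s t, b = s ^+ 2 + s * t + a * t ^+ 2.
  move=> pq0 n0; have q0 : q != 0.
    apply: contra pq0 => /eqP q0; move: n0; rewrite q0 !mulr0 expr0n mulr0 subr0 addr0.
    by move/eqP; rewrite eqxx andbT sqrf_eq0.
  have aE : a = (p / q) ^+ 2 + p / q.
    apply/eqP; rewrite -subr_eq0; apply/eqP.
    by rewrite -[RHS](mul0r (- q ^- 2)) -n0; field.
  (* With r = p / q and a = r^2 + r, the norm factors as (s + r t) (s + (r + 1) t); this choice
     makes the factors 1 and b. *)
  exists (1 + p / q * (b + 1)), (b + 1); rewrite aE.
  set r := p / q.
  apply: (char2_eq K2
    (z := - (1 + r * (b + 1) + r ^+ 2 * (b + 1) ^+ 2 + r * (b + 1) ^+ 2))).
  by ring.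
move=> u0 N0; have [zt0|zt0] := eqVneq (z ^+ 2 + z * t - a * t ^+ 2) 0.
  have xy0 : x ^+ 2 + x * y - a * y ^+ 2 = 0 by rewrite -N0 zt0 mulr0 subr0.
  have [/andP[/eqP z0 /eqP t0]|zt] := boolP ((z == 0) && (t == 0)).
    apply: iso xy0; apply: contra u0 => /andP[/eqP -> /eqP ->].
    by rewrite z0 t0 -Quat0.
  exact: iso zt zt0.
set n := z ^+ 2 + z * t - a * t ^+ 2 in N0 zt0.
(* Coordinates of the quotient (x + y i) / (z + t i), that is (x + y i) times the conjugate of z + t
   i over its norm. *)
exists ((x * (z + t) - a * y * t) / n), ((y * z - x * t) / n).
have -> : b = (x ^+ 2 + x * y - a * y ^+ 2) / n.
  by rewrite -[X in X / n](subrK (b * n)) N0 add0r mulfK.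
apply: (char2_eq K2 (z := - (a * ((y * z - x * t) / n) ^+ 2))).
by rewrite /n in zt0 *; field.
Qed.

End QuatSplit.

Section SplitConverse.
Variables (K : fieldType).

(* K^(s+1) is a module over A and the matrix units e_ij. If w = v e_ii, the     *)
(* map (a_j)_j |-> \sum_j w a_j e_ij is not injective by the dimension          *)
(* assumption, and applying e_ki to a relation gives w a_k = 0.                 *)
Lemma mx_isom_action (A : falgType K) r s :
  alg_isom (tensalg A 'M[K]_r.+1) 'M[K]_s.+1 -> (s.+1 < r.+1 * \dim {:A})%N ->
  exists (D : {lrmorphism A -> 'M[K]_s.+1}) (w : 'rV[K]_s.+1) (a : A),
    [/\ w != 0, a != 0 & w *m D a = 0].
Proof.
case=> h hb ltsr.
pose D : {lrmorphism A -> 'M[K]_s.+1} := h \o @tinl _ _ idfun A 'M[K]_r.+1.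
pose E : {lrmorphism 'M[K]_r.+1 -> 'M[K]_s.+1} := h \o @tinr _ _ idfun A 'M[K]_r.+1.
have DE u m : D u * E m = E m * D u.
  by rewrite /D /E /= -!rmorphM tinlr tinrl.
clearbody D E; pose e i j := E (delta_mx i j).
have eM i j k : e i j * e j k = e i k by rewrite /e -rmorphM /= -mulmxE mul_delta_mx.
have eM0 i j j' k : j != j' -> e i j * e j' k = 0.
  by move=> jj'; rewrite /e -rmorphM -mulmxE mul_delta_mx_0 ?raddf0.
have [i ei0] : exists i, e i i != 0.
  apply/existsP; rewrite -negb_forall; apply/negP=> /forallP e0.
  have: E 1 = 0.
    rewrite [1]matrix_sum_delta raddf_sum big1 // => i _ /=.
    rewrite raddf_sum big1 // => j _ /=; rewrite linearZ /=.
    rewrite mxE; have [<-|] := eqVneq i j; last by rewrite scale0r.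
    by rewrite -[E _]/(e i i) (eqP (e0 i)) scaler0.
  by rewrite rmorph1 => /eqP; rewrite oner_eq0.
have [v vE] : exists v : 'rV_s.+1, v *m e i i != 0.
  have [k ek0] : exists k, row k (e i i) != 0.
    apply/existsP; rewrite -negb_forall; apply: contra ei0 => /forallP e0.
    by apply/eqP/row_matrixP=> k; rewrite (eqP (e0 k)) row0.
  by exists (delta_mx 0 k); rewrite -rowE.
pose w := v *m e i i.
have we : w *m e i i = w by rewrite /w -mulmxA mulmxE eM.
pose Phi0 (d : {ffun 'I_r.+1 -> A}) : 'rV[K]_s.+1 := \sum_j w *m (D (d j) * e i j).
have PhiL : linear Phi0.
  move=> c d d'; rewrite /Phi0 scaler_sumr -big_split; apply: eq_bigr => j _.
  by rewrite !ffunE linearP /= mulrDl mulmxDr -scalerAl -scalemxAr.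
pose Phi : {linear {ffun 'I_r.+1 -> A} -> 'rV[K]_s.+1} :=
  HB.pack Phi0 (GRing.isLinear.Build _ _ _ _ Phi0 PhiL).
have kerPhi : lker (linfun Phi) != 0%VS.
  apply: contraTneq ltsr => k0; rewrite -leqNgt.
  have := limg_ker_dim (linfun Phi) fullv; rewrite k0 capv0 dimv0 add0n.
  have -> : \dim {:{ffun 'I_r.+1 -> A}} = (r.+1 * \dim {:A})%N.
    by rewrite !dimvf /= /dim /= card_ord.
  move=> <-; apply: leq_trans (dimvS (subvf _)) _.
  by rewrite dimvf /dim /= mul1n.
have := memv_pick (lker (linfun Phi)); rewrite -vpick0 in kerPhi.
move: (vpick _) kerPhi => d d0; rewrite memv_ker lfunE /= => /eqP Pd0.
have [k dk0] : exists k, d k != 0.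
  apply/existsP; rewrite -negb_forall; apply: contra d0 => /forallP e0.
  by apply/eqP/ffunP=> k; rewrite (eqP (e0 k)) ffunE.
exists D, w, (d k); split=> //.
have := congr1 (mulmx^~ (e k i)) Pd0; rewrite mul0mx => <-.
rewrite /Phi0 mulmx_suml (bigD1 k) //= big1 => [|j jk].
  rewrite addr0 -mulmxA mulmxE -mulrA eM DE -mulmxE mulmxA.
  by rewrite we.
by rewrite -mulmxA mulmxE -mulrA eM0 // mulr0 mulmx0.
Qed.

(** Triviality gives an isomorphism of H tensored with a matrix algebra onto a matrix algebra, hence
    a row w != 0 and u != 0 in H with w u = 0. Multiplying by the conjugate of u gives N(u) w = 0,
    so the reduced norm is isotropic. *)
Lemma quat_split_norm (K2 : 2%N \in [pchar K]) (a b : K) : b != 0 ->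
  brauer_trivial (quat a b) -> exists s t, b = s ^+ 2 + s * t + a * t ^+ 2.
Proof.
move=> b0 [r [s]] /alg_isom_trans/(_ (tensalg1l _)) iso.
have dE := alg_isom_dim iso; rewrite dim_tensor dim_quat !dimvf /dim /= in dE.
(* The dimensions give (s + 1)^2 = 4 (r + 1)^2, so s + 1 = 2 (r + 1), which is below 4 (r + 1). *)
have lt : (s.+1 < r.+1 * \dim {:quat a b})%N by rewrite dim_quat; nia.
have [D [w [u [w0 u0 wu]]]] := mx_isom_action iso lt.
elim/QuatP: u u0 wu => x y z t u0 wu.
apply: (quat_isotropic K2 u0); apply/eqP.
have := congr1 (mulmx^~ (D (Quat a b (x + y) (- y) (- z) (- t)))) wu.
rewrite mul0mx -mulmxA mulmxE -rmorphM /= quat_conj linearZ /= rmorph1.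
by rewrite -scalemxAr mulmx1 => /eqP; rewrite scaler_eq0 (negPf w0) orbF.
Qed.

End SplitConverse.

(** * Bilinearity of symbols *)

Lemma scalar_ext_quat (K L : fieldType) (phi : {rmorphism K -> L}) (a b : K) :
  alg_isom (scalar_ext phi (quat a b)) (quat (phi a) (phi b)).
Proof.
pose f0 (u : quat a b) : quat (phi a) (phi b) :=
  let: (x, y, z, t) := u in Quat _ _ (phi x) (phi y) (phi z) (phi t).
have f0E x y z t : f0 (Quat a b x y z t) = Quat _ _ (phi x) (phi y) (phi z) (phi t).
  by rewrite /f0 unlock.
have fA : zmod_morphism f0.
  elim/QuatP=> x y z t; elim/QuatP=> x' y' z' t'.
  by rewrite -!scaleN1r !QuatZ QuatD !f0E QuatZ QuatD !rmorphD !rmorphM !rmorphN1.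
have fM : monoid_morphism f0.
  split; first by rewrite !Quat1 f0E rmorph1 !rmorph0.
  elim/QuatP=> x y z t; elim/QuatP=> x' y' z' t'.
  rewrite QuatM !f0E QuatM.
  by congr (Quat _ _ _ _ _ _); rewrite ?(rmorphD, rmorphM, rmorphN).
have fZ c u : f0 (c *: u) = phi c *: f0 u.
  by elim/QuatP: u => x y z t; rewrite QuatZ !f0E QuatZ !rmorphM.
pose f : {rmorphism quat a b -> quat (phi a) (phi b)} := HB.pack f0
  (GRing.isZmodMorphism.Build _ _ f0 fA) (GRing.isMonoidMorphism.Build _ _ f0 fM).
apply: (scalar_ext_isom_of (f := f) fZ) => [|h hE]; first by rewrite !dim_quat.
have f1 : f 1 = 1 by rewrite rmorph1.
have fi : f (qi a b) = qi _ _ by rewrite -[f _]/(f0 _) /qi f0E rmorph1 !rmorph0.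
have fj : f (qj a b) = qj _ _ by rewrite -[f _]/(f0 _) /qj f0E rmorph1 !rmorph0.
elim/QuatP=> x y z t; rewrite QuatE -fi -fj -f1 -rmorphM -!hE.
exists (x *: tpure phi 1 1 + y *: tpure phi (qi a b) 1 + z *: tpure phi (qj a b) 1
  + t *: tpure phi (qi a b * qj a b) 1).
by rewrite !linearD !linearZ.
Qed.

Section TensQuat.
Variables (K : fieldType) (K2 : 2%N \in [pchar K]).
Local Notation id_K := (idfun : {rmorphism K -> K}).

Section Gen.
Variables (a b : K) (C : falgType K) (h : {lrmorphism quat a b -> C}).
Variable P : C -> Prop.
Hypotheses (P1 : P 1) (PD : forall x y, P x -> P y -> P (x + y)).
Hypotheses (PZ : forall c x, P x -> P (c *: x))
  (PM : forall x y, P x -> P y -> P (x * y)).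

Lemma quat_gen : P (h (qi a b)) -> P (h (qj a b)) -> forall u, P (h u).
Proof.
move=> Pi Pj; elim/QuatP=> x y z t; rewrite QuatE !linearD !linearZ rmorphM rmorph1 /=.
by do ?[apply: PD | apply: PZ | apply: PM].
Qed.

End Gen.

Lemma quat_comm a b (C : falgType K) (h : {lrmorphism quat a b -> C}) v :
  h (qi a b) * v = v * h (qi a b) -> h (qj a b) * v = v * h (qj a b) ->
  forall u, h u * v = v * h u.
Proof.
apply: (quat_gen (P := fun x => x * v = v * x)) => [|x y xv yv|c x xv|x y xv yv].
- by rewrite mul1r mulr1.
- by rewrite mulrDl mulrDr xv yv.
- by rewrite -scalerAl -scalerAr xv.
- by rewrite mulrA -xv -!mulrA yv.
Qed.

(** Tool for re-presenting a tensor product of two symbols by another pair of commuting symbols. The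
    last hypothesis says that the four new elements generate: whatever is closed under the
    operations and contains them contains the four standard generators. *)
Lemma quat_tens_isom (a b a' b' p q r s : K)
    (T0 := tensalg (quat a b) (quat a' b')) (I1 J1 I2 J2 : T0) :
  I1 * I1 = I1 + p%:A -> J1 * J1 = q%:A -> J1 * I1 = J1 - I1 * J1 ->
  I2 * I2 = I2 + r%:A -> J2 * J2 = s%:A -> J2 * I2 = J2 - I2 * J2 ->
  I1 * I2 = I2 * I1 -> I1 * J2 = J2 * I1 -> J1 * I2 = I2 * J1 -> J1 * J2 = J2 * J1 ->
  (forall P : T0 -> Prop, (forall x y, P x -> P y -> P (x + y)) ->
     (forall c x, P x -> P (c *: x)) -> (forall x y, P x -> P y -> P (x * y)) ->
     P I1 -> P J1 -> P I2 -> P J2 ->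
     [/\ P (tpure id_K (qi a b) 1), P (tpure id_K (qj a b) 1),
         P (tpure id_K 1 (qi a' b')) & P (tpure id_K 1 (qj a' b'))]) ->
  alg_isom (tensalg (quat p q) (quat r s)) T0.
Proof.
move=> II1 JJ1 JI1 II2 JJ2 JI2 ii ij ji jj gen.
have [f [fi fj]] := quat_lift II1 JJ1 JI1; have [g [gi gj]] := quat_lift II2 JJ2 JI2.
apply: (tensalg_isom (f := f) (g := g)) => [u v||h hf hg].
- by apply: quat_comm; apply/esym; apply: quat_comm; rewrite ?fi ?fj ?gi ?gj.
- by rewrite dim_tensor !dim_quat.
pose P y := exists x, h x = y.
have P1 : P 1 by exists 1; rewrite rmorph1.
have PD x y : P x -> P y -> P (x + y).
  by move=> [x' <-] [y' <-]; exists (x' + y'); rewrite rmorphD.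
have PZ c x : P x -> P (c *: x) by move=> [x' <-]; exists (c *: x'); rewrite linearZ.
have PM x y : P x -> P y -> P (x * y).
  by move=> [x' <-] [y' <-]; exists (x' * y'); rewrite rmorphM.
have [||||Pi1 Pj1 Pi2 Pj2] := gen P PD PZ PM.
- by exists (tpure id_K (qi p q) 1); rewrite hf.
- by exists (tpure id_K (qj p q) 1); rewrite hf.
- by exists (tpure id_K 1 (qi r s)); rewrite hg.
- by exists (tpure id_K 1 (qj r s)); rewrite hg.
pose l : {lrmorphism quat a b -> T0} := @tinl _ _ id_K _ _.
pose m : {lrmorphism quat a' b' -> T0} := @tinr _ _ id_K _ _.
apply: tensor_gen; first exact: (quat_gen (h := l) P1 PD PZ PM).
exact: (quat_gen (h := m) P1 PD PZ PM).
Qed.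

Section Relations.
Variables (a b a' b' : K).
Local Notation T := (tensalg (quat a b) (quat a' b')).
Let i1 : T := tpure id_K (qi a b) 1.
Let j1 : T := tpure id_K (qj a b) 1.
Let i2 : T := tpure id_K 1 (qi a' b').
Let j2 : T := tpure id_K 1 (qj a' b').

Let T2 (A : falgType K) : 2%N \in [pchar A]. Proof. by rewrite pchar_lalg. Qed.

Lemma tens_quat_rel :
  [/\ i1 * i1 = i1 + a%:A, j1 * j1 = b%:A & j1 * i1 = j1 + i1 * j1] /\
  [/\ i2 * i2 = i2 + a'%:A, j2 * j2 = b'%:A & j2 * i2 = j2 + i2 * j2] /\
  [/\ i2 * i1 = i1 * i2, i2 * j1 = j1 * i2, j2 * i1 = i1 * j2 & j2 * j1 = j1 * j2].
Proof.
rewrite /i1 /i2 /j1 /j2 !tpureM !mul1r !mulr1 !qii !qjj !qji !(oppr_pchar2 (T2 _)).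
by rewrite !(tpureDl, tpureDr, tpureZl, tpureZr) tpure1.
Qed.

(** Conjugation by j_1 j_2 adds 1 to both i_1 and i_2, hence fixes their sum. *)
Lemma tens_quat_rel2 :
  [/\ (i1 + i2) * (i1 + i2) = i1 + i2 + (a + a')%:A,
      j1 * j2 * (j1 * j2) = (b * b')%:A,
      j1 * j2 * i1 = j1 * j2 - i1 * (j1 * j2),
      j1 * j2 * i2 = j1 * j2 - i2 * (j1 * j2) &
      j1 * j2 * (i1 + i2) = (i1 + i2) * (j1 * j2)].
Proof.
have [[ii1 jj1 ji1] [[ii2 jj2 ji2] [i21 ij21 ji21 j21]]] := tens_quat_rel.
have Ji1 : j1 * j2 * i1 = j1 * j2 + i1 * (j1 * j2).
  by rewrite -mulrA ji21 mulrA ji1 mulrDl mulrA.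
have Ji2 : j1 * j2 * i2 = j1 * j2 + i2 * (j1 * j2).
  by rewrite -mulrA ji2 mulrDr !mulrA ij21.
rewrite !(oppr_pchar2 (T2 _)); split=> //.
- rewrite mulrDl !mulrDr i21 ii1 ii2 -addrA [i1 * i2 + (_ + _)]addrA.
  by rewrite (addrr_pchar2 (T2 _)) add0r addrACA -scalerDl.
- rewrite -mulrA [j2 * _]mulrA j21 -!mulrA jj2 !mulrA jj1.
  by rewrite -scalerAl mul1r scalerA.
by rewrite mulrDr Ji1 Ji2 addrACA (addrr_pchar2 (T2 _)) add0r -mulrDl.
Qed.

End Relations.

(* Besides i_1 and j_1 j_2, which generate [a, b b'), the tensor product        *)
(* contains the commuting split algebra [0, b') generated by i_1 + i_2, j_2.    *)
Lemma symbol_mul (a b b' : K) : b != 0 -> b' != 0 ->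
  brauer_equiv (tensalg (quat a b) (quat a b')) (quat a (b * b')).
Proof.
move=> b0 b'0.
have T2 (A : falgType K) : 2%N \in [pchar A] by rewrite pchar_lalg.
have [[ii1 jj1 ji1] [[ii2 jj2 ji2] [i21 ij21 ji21 j21]]] := tens_quat_rel a b a b'.
have [sii sjj ji ji' jii] := tens_quat_rel2 a b a b'.
apply: brauer_sym; have split0 : brauer_trivial (quat 0 b').
  apply: brauer_trans (isom_brauer (quat_mx K2 b'0 (s := 1) (t := b' + 1) _)) _.
    by apply: (char2_eq K2 (z := - 1)); ring.
  exact: mx_brauer_trivial.
apply: brauer_trans (brauer_sym (brauer_trivial_tensr (quat a (b * b')) split0)) _.
rewrite (addrr_pchar2 K2) in sii.
apply: isom_brauer; apply: (quat_tens_isom ii1 sjj ji sii jj2).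
- by rewrite (oppr_pchar2 (T2 _)) mulrDr ji2 ji21 mulrDl addrCA.
- by rewrite mulrDr mulrDl i21.
- by rewrite ji21.
- exact: jii.
- by rewrite mulrA j21.
move=> P PD PZ PM Pi1 PJ PI Pj2; split=> //.
- have := PZ b'^-1 _ (PM _ _ PJ Pj2).
  by rewrite -mulrA jj2 -scalerAr mulr1 scalerK.
- rewrite -[X in P X](addKr (tpure id_K (qi a b) 1)) (oppr_pchar2 (T2 _)).
  exact: PD.
Qed.

(* Here [a + a', b) is generated by i_1 + i_2 and j_1, and it commutes with     *)
(* the split algebra [a', b^2) generated by i_2 and j_1 j_2.                    *)
Lemma symbol_add (a a' b : K) : b != 0 ->
  brauer_equiv (tensalg (quat a b) (quat a' b)) (quat (a + a') b).
Proof.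
move=> b0; have bb0 : b * b != 0 by rewrite mulf_neq0.
have T2 (A : falgType K) : 2%N \in [pchar A] by rewrite pchar_lalg.
have [[ii1 jj1 ji1] [[ii2 jj2 ji2] [i21 ij21 ji21 j21]]] := tens_quat_rel a b a' b.
have [sii sjj ji ji' jii] := tens_quat_rel2 a b a' b.
apply: brauer_sym; have split0 : brauer_trivial (quat a' (b * b)).
  apply: brauer_trans (isom_brauer (quat_mx K2 bb0 (s := b) (t := 0) _)) _.
    by ring.
  exact: mx_brauer_trivial.
apply: brauer_trans (brauer_sym (brauer_trivial_tensr (quat (a + a') b) split0)) _.
apply: isom_brauer; apply: (quat_tens_isom sii jj1 _ ii2 sjj ji').
- by rewrite (oppr_pchar2 (T2 _)) mulrDr ji1 -ij21 mulrDl addrA.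
- by rewrite mulrDr mulrDl i21.
- by rewrite jii.
- by rewrite ij21.
- by rewrite -[RHS]mulrA j21.
move=> P PD PZ PM PI Pj1 Pi2 PJ; split=> //.
- rewrite -[X in P X](addrK (tpure id_K 1 (qi a' b))) (oppr_pchar2 (T2 _)).
  exact: PD.
- have := PZ b^-1 _ (PM _ _ Pj1 PJ).
  by rewrite mulrA jj1 -scalerAl mul1r scalerK.
Qed.

Lemma symbol_self (b : K) : b != 0 -> brauer_trivial (quat b b).
Proof.
move=> b0; apply: brauer_trans (isom_brauer (quat_mx K2 b0 (s := 0) (t := 1) _)) _.
  by ring.
exact: mx_brauer_trivial.
Qed.

Lemma symbol_sqr (a c : K) : c != 0 -> brauer_trivial (quat a (c ^+ 2)).
Proof.
move=> c0; have cc0 : c ^+ 2 != 0 by rewrite expf_neq0.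
apply: brauer_trans (isom_brauer (quat_mx K2 cc0 (s := c) (t := 0) _)) _.
  by ring.
exact: mx_brauer_trivial.
Qed.

End TensQuat.

(** * Quaternion algebras in characteristic 2 *)

Lemma quadratic_span (K : fieldType) (A : falgType K) (E : {vspace A}) x y :
  (1 <= E)%VS -> \dim E = 2%N -> x \in E -> x \notin 1%VS -> y \in E ->
  exists t n, y = t *: x + n%:A.
Proof.
move=> E1 dE xE x1; have fr : free [:: x; 1].
  by rewrite free_cons seq1_free oner_eq0 andbT span_seq1.
have -> : E = <<[:: x; 1%R]>>%VS.
  apply/esym/eqP; rewrite eqEdim dE (eqP fr) andbT span_cons span_seq1 subv_add.
  by rewrite E1 andbT -memvE.
rewrite span_cons span_seq1 => /memv_addP[_ /vlineP[t ->] [_ /vlineP[n ->] ->]].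
by exists t, n.
Qed.

Section Classification.
Variables (K : fieldType) (A : falgType K) (csA : central_simple A).

Lemma central_simple_inj (C : falgType K) (h : {lrmorphism A -> C}) : injective h.
Proof.
have kerP x : (x \in lker (linfun h)) = (h x == 0) by rewrite memv_ker lfunE.
have [|||k0] := csA.2 (lker (linfun h)).
- by apply/prodvP=> u v _; rewrite !kerP rmorphM /= => /eqP ->; rewrite mulr0.
- by apply/prodvP=> u v; rewrite !kerP rmorphM /= => /eqP -> _; rewrite mul0r.
- by move/eqP/lker0P => hI x y hxy; apply: hI; rewrite !lfunE.
have: (1 : A) \in lker (linfun h) by rewrite k0 memvf.
by rewrite kerP rmorph1 oner_eq0.
Qed.

Lemma central_in1 (x : A) : (forall y, x * y = y * x) -> x \in 1%VS.
Proof. by move=> xC; rewrite -csA.1 memv_cap memvf; apply/centvP=> y _. Qed.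

(** Right multiplication on R, with the coordinates of each image written as a row: in this
    convention the matrix of u v is the product of those of u and v in the same order. *)
Lemma right_ideal_action (R : {vspace A}) d (X : d.+1.-tuple A) :
  basis_of R X -> (forall u v, u \in R -> u * v \in R) ->
  exists h : {lrmorphism A -> 'M[K]_d.+1},
    h =1 fun u => \matrix_(i, j) coord X j (X`_i * u).
Proof.
move=> bX Rr; have fX := basis_free bX.
have XR i : X`_i \in R by case: (ltnP i (size X)) => [iX|iX];
  [apply: (basis_mem bX); rewrite mem_nth | rewrite nth_default ?mem0v].
pose h0 (u : A) : 'M[K]_d.+1 := \matrix_(i, j) coord X j (X`_i * u).
have hL : linear h0.
  by move=> c u v; apply/matrixP=> i j; rewrite !mxE mulrDr -scalerAr linearP.
have hM : monoid_morphism h0.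
  split=> [|u v]; apply/matrixP=> i j; rewrite !mxE.
    by rewrite mulr1 coord_free // eq_sym.
  rewrite mulrA {1}(coord_basis bX (Rr _ u (XR i))) mulr_suml linear_sum /=.
  by apply: eq_bigr => k _; rewrite !mxE -scalerAl linearZ.
by have [h hE] := lrmorphism_of hL hM; exists h.
Qed.

Hypothesis dimA : \dim {:A} = 4%N.

(** The action on R is faithful by simplicity, and a 4-dimensional algebra embeds in matrices of
    size at most 2 only as all of ['M[K]_2]. *)
Lemma right_ideal_isom (R : {vspace A}) : R != 0%VS -> (\dim R <= 2)%N ->
  (forall u v, u \in R -> u * v \in R) -> alg_isom A 'M[K]_2.
Proof.
rewrite -dimv_eq0 => R0 R2 Rr.
have [d dR] : exists d, \dim R = d.+1 by case: (\dim R) R0 => // d _; exists d.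
have bX := vbasisP R; move: (vbasis R) bX; rewrite dR => X bX.
have [h _] := right_ideal_action bX Rr; have hI := central_simple_inj (h := h).
have : (\dim {:A} <= \dim {:'M[K]_d.+1})%N.
  have k0 : lker (linfun h) == 0%VS by apply/lker0P=> x y; rewrite !lfunE; apply: hI.
  have <- : \dim (limg (linfun h)) = \dim {:A} by rewrite limg_dim_eq // (eqP k0) capv0.
  exact/dimvS/subvf.
have dM : \dim {:'M[K]_d.+1} = (d.+1 * d.+1)%N by rewrite dimvf.
rewrite dimA dM => d2; have d1 : d = 1%N by rewrite dR in R2; clear -d2 R2; nia.
move: h hI dM; rewrite d1 => h hI dM.
by exists h; apply: inj_bij hI; rewrite dimA dM.
Qed.

(** The right ideal x A and the right annihilator of x are both nonzero and their dimensions add up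
    to 4, so one of them has dimension at most 2. *)
Lemma nonunit_isom (x : A) : x != 0 -> x \isn't a GRing.unit -> alg_isom A 'M[K]_2.
Proof.
move=> x0 xU; pose f := amull x.
have fE y : f y = x * y by rewrite lfunE.
have k0 : lker f != 0%VS.
  apply: contra xU => k0; have dl : limg f = fullv.
    by apply/eqP; rewrite eqEdim subvf limg_dim_eq ?(eqP k0) ?capv0 /=.
  have /memv_imgP[y _] : 1 \in limg f by rewrite dl memvf.
  rewrite fE => xy; apply/unitrP; exists y; split=> //.
  by apply: (lker0P k0); rewrite !fE mulrA -xy mul1r mulr1.
have l0 : limg f != 0%VS.
  apply: contraNneq x0 => l0; rewrite -memv0 -l0 -[x in x \in _]mulr1 -fE.
  by rewrite memv_img ?memvf.
have := limg_ker_dim f fullv; rewrite capfv dimA => dims.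
have [k2|l2] : (\dim (lker f) <= 2 \/ \dim (limg f) <= 2)%N by lia.
  apply: right_ideal_isom k0 k2 _ => u v; rewrite !memv_ker !fE mulrA.
  by move/eqP->; rewrite mul0r.
apply: right_ideal_isom l0 l2 _ => u v /memv_imgP[y _ ->].
by rewrite fE -mulrA -fE memv_img ?memvf.
Qed.

(** The dimension of K(x) divides 4. It is not 1 as x is not in K, and not 4 since then A would
    centralize x; so K(x) is spanned by x and 1. *)
Lemma division_quadratic (x : A) : GRing.field_axiom A -> x \notin 1%VS ->
  exists t n, x ^+ 2 = t *: x + n%:A.
Proof.
move=> fA x1; pose E := <<1; x>>%AS.
have xE : x \in E := memv_adjoin _ _.
have E1 : (1 <= E)%VS.
  by apply: subv_trans (sub1_agenv _) (agenvS (addvSl _ _)).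
have EC : (E <= 'C[x])%VS.
  apply: agenv_sub_modl.
    apply/subvP=> _ /vlineP[c ->]; apply/cent1vP.
    by rewrite -scalerAl -scalerAr mul1r mulr1.
  apply/prodvP=> u v /memv_addP[_ /vlineP[c ->] [_ /vlineP[c' ->] ->]] /cent1vP vx.
  apply/cent1vP; rewrite -mulrA vx mulrA [in RHS]mulrA; congr (_ * _).
  by rewrite mulrDl mulrDr -!scalerAl -!scalerAr mul1r mulr1.
have dE : \dim E = 2%N.
  have := skew_field_dimS fA (subvf E : (E <= {:A}%AS)%VS); rewrite /= dimA.
  have E4 : \dim E != 4%N.
    apply: contra x1 => E4; apply: central_in1 => y.
    have /subvP/(_ y) : ({:A} <= 'C[x])%VS.
      apply: subv_trans EC; have := eqEdim E {:A}; rewrite subvf dimA (eqP E4) => /eqP ->.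
      exact: subvv.
    by rewrite memvf => /(_ isT)/cent1vP.
  have E1' : \dim E != 1%N.
    apply: contra x1 => E1'; have := eqEdim 1 E; rewrite E1 dimv1 (eqP E1') => /eqP ->.
    exact: xE.
  move=> dv; have := dvdn_leq (ltn0Sn 3) dv; move: dv E4 E1'; rewrite /E /=.
  by case: (\dim <<1; x>>) => [|[|[|[|[|n]]]]].
have [t [n xx]] := quadratic_span E1 dE xE x1 (memvM xE xE).
by exists t, n; rewrite expr2.
Qed.

Hypothesis K2 : 2%N \in [pchar K].

(* Otherwise all squares are central, hence so are all xy + yx; then            *)
(* x (xy + yx) = x (xy) + (xy) x is central too, so that A is commutative.      *)
Lemma division_separable : GRing.field_axiom A ->
  exists (i : A) a, i \notin 1%VS /\ i * i = i + a%:A :> A.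
Proof.
move=> fA; apply: NNPP => nosep.
have A2 : 2%N \in [pchar A] by rewrite pchar_lalg.
have sq (x : A) : x ^+ 2 \in 1%VS.
  have [/vlineP[c ->]|x1] := boolP (x \in 1%VS).
    by rewrite exprZn expr1n memvZ ?memv_line.
  have [t [n xE]] := division_quadratic fA x1.
  have [t0|t0] := eqVneq t 0; first by rewrite xE t0 scale0r add0r memvZ ?memv_line.
  case: nosep; exists (t^-1 *: x), (n / t ^+ 2); split.
    by apply: contra x1 => /(memvZ t); rewrite scalerA mulfV // scale1r.
  rewrite -scalerAl -scalerAr -expr2 xE !scalerDr !scalerA; congr (_ *: _ + _ *: _).
    by field.
  by field.
have com (x y : A) : x * y + y * x \in 1%VS.
  suff -> : x * y + y * x = (x + y) ^+ 2 - x ^+ 2 - y ^+ 2 by rewrite !memvB.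
  rewrite !expr2 mulrDl !mulrDr [X in X - _ - _]addrA [RHS]addrAC addrK.
  by rewrite -[X in X - _]addrA [RHS]addrC addKr.
have all1 (x : A) : x \in 1%VS.
  apply: central_in1 => y; have /vlineP[c cE] := com x y.
  have [c0|c0] := eqVneq c 0.
    by apply/eqP; rewrite -subr_eq0 (oppr_pchar2 A2) cE c0 scale0r.
  have : x * (x * y) + x * y * x = c *: x.
    by rewrite -mulrA -mulrDr cE -scalerAr mulr1.
  move=> xE; have: c *: x \in 1%VS by rewrite -xE com.
  move/(memvZ c^-1); rewrite scalerK // => /vlineP[d ->].
  by rewrite -scalerAl -scalerAr mul1r mulr1.
have: (\dim {:A} <= \dim (1%VS : {vspace A}))%N.
  by apply: dimvS; apply/subvP=> x _; apply: all1.
by rewrite dimv1 dimA.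
Qed.

(** If A is not a division algebra, it is the matrix algebra [0, 1). Otherwise [division_separable]
    provides i, and j is found as a commutator with i. *)
Lemma quaternionP : exists a b, b != 0 /\ alg_isom (quat a b) A.
Proof.
have A2 : 2%N \in [pchar A] by rewrite pchar_lalg.
have [fA|] := classic (GRing.field_axiom A); last first.
  move=> /not_all_ex_not[x nx]; exists 0, 1; split; first exact: oner_neq0.
  have [x0 xU] : x != 0 /\ x \isn't a GRing.unit.
    by split; apply/negP=> h; apply: nx; rewrite ?h // => /negP.
  apply: alg_isom_trans (alg_isom_sym (nonunit_isom x0 xU)).
  by apply: (quat_mx K2 (oner_neq0 _) (s := 1) (t := 0)); ring.
have [i [a [i1 ii]]] := division_separable fA.
have [y iy] : exists y : A, i * y != y * i.
  apply: NNPP => nex; case/negP: i1; apply: central_in1 => y.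
  by apply/eqP/negPn/negP=> iy; apply: nex; exists y.
(* In characteristic 2 the map D = [i, -] satisfies D^2 = [i^2, -] = D, so the nonzero element j =
   D(y) satisfies i j + j i = j. *)
pose j := y * i + i * y.
have j0 : j != 0 by rewrite /j addr_eq0 (oppr_pchar2 A2) eq_sym.
have ji : j * i = j - i * j.
  rewrite (oppr_pchar2 A2) /j mulrDl mulrDr -mulrA !ii [i * (i * y)]mulrA ii.
  rewrite mulrDr mulrDl -scalerAl -scalerAr mul1r mulr1 mulrA.
  rewrite -!addrA; congr (_ + _); rewrite [RHS]addrCA.
  by rewrite [i * y + (i * y + _)]addrA (addrr_pchar2 A2) add0r addrC.
have j1 : j \notin 1%VS.
  apply/negP=> /vlineP[c jE]; case/eqP: j0.
  have ij : j * i = i * j by rewrite jE -scalerAl -scalerAr mul1r mulr1.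
  by move/eqP: ji; rewrite ij eq_sym subr_eq (addrr_pchar2 A2) => /eqP.
have [t [b jE]] := division_quadratic fA j1.
have ji2 : j * i - i * j = j by rewrite ji -addrA -opprD (addrr_pchar2 A2) subr0.
(* Since j i = (1 + i) j, the square j^2 = t j + b commutes with i; hence so does t j, while [j, i]
   = j is nonzero. *)
have t0 : t = 0.
  have jjC : j ^+ 2 * i = i * j ^+ 2.
    rewrite expr2 -mulrA [in LHS]ji mulrBr [j * (i * j)]mulrA ji mulrBl.
    by rewrite opprB addrC subrK mulrA.
  have /eqP : t *: j = 0.
    rewrite -ji2 scalerBr scalerAl scalerAr.
    move: jjC; rewrite jE mulrDl mulrDr -[X in _ + X]scalerAl -[X in _ = _ + X]scalerAr.
    by rewrite mul1r mulr1 => /addIr ->; rewrite subrr.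
  by rewrite scaler_eq0 (negPf j0) orbF => /eqP.
have jj : j * j = b%:A by rewrite -expr2 jE t0 scale0r add0r.
have b0 : b != 0.
  apply: contra j0 => /eqP b0; move: jj; rewrite b0 scale0r => jj.
  apply/negPn/negP=> jn0; have jI := mulrI (fA _ jn0).
  by case/eqP: jn0; apply: jI; rewrite jj mulr0.
by exists a, b; split=> //; apply: (quat_isom K2 b0 dimA ii jj ji).
Qed.

End Classification.

(** * Sums of symbols and descent *)

Definition symbols (K : fieldType) (s : seq (K * K)) : falgType K :=
  \big[@tensalg K/K^o : falgType K]_(p <- s) quat p.1 p.2.

Notation "s =br t" := (brauer_equiv (symbols s) (symbols t)) (at level 70).

Section Symbols.
Variable K : fieldType.
Implicit Types (s t u : seq (K * K)) (p q : K * K).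

Lemma symbols_cons p s : symbols (p :: s) = tensalg (quat p.1 p.2) (symbols s).
Proof. exact: big_cons. Qed.

Lemma symbols0 : symbols [::] = K^o :> falgType K.
Proof. exact: big_nil. Qed.

Lemma symbols1 (a b : K) : brauer_equiv (symbols [:: (a, b)]) (quat a b).
Proof. by rewrite symbols_cons symbols0; apply/isom_brauer/tensalg1r. Qed.

Lemma symbols_cat s t : brauer_equiv (symbols (s ++ t)) (tensalg (symbols s) (symbols t)).
Proof.
elim: s => [|p s IH].
  by rewrite symbols0; apply/brauer_sym/isom_brauer/tensalg1l.
rewrite cat_cons !symbols_cons.
apply: brauer_trans (isom_brauer (alg_isom_sym (tensalgA _ _ _))).
exact: brauer_tens (brauer_refl _) IH.
Qed.

Lemma symbols_cat_equiv s s' t t' : s =br s' -> t =br t' -> s ++ t =br s' ++ t'.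
Proof.
move=> ss' tt'; apply: brauer_trans (symbols_cat _ _) _.
exact: brauer_trans (brauer_tens ss' tt') (brauer_sym (symbols_cat _ _)).
Qed.

Lemma symbols_perm s t : perm_eq s t -> s =br t.
Proof.
move=> st; pose P t := s =br t.
apply: (catCA_perm_ind (P := P) _ st (brauer_refl _)) => t1 t2 t3 H.
apply: brauer_trans H _; rewrite !catA.
apply: symbols_cat_equiv (brauer_refl _).
apply: brauer_trans (symbols_cat _ _) _.
apply: brauer_trans (isom_brauer (tensalgC _ _)) _.
exact: brauer_sym (symbols_cat _ _).
Qed.

Lemma symbols_isom (a b a' b' : K) : alg_isom (quat a b) (quat a' b') ->
  [:: (a, b)] =br [:: (a', b')].
Proof.
move=> /isom_brauer H; apply: brauer_trans (symbols1 _ _) _.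
exact: brauer_trans H (brauer_sym (symbols1 _ _)).
Qed.

Lemma symbols2 (a b a' b' c d : K) :
  brauer_equiv (tensalg (quat a b) (quat a' b')) (quat c d) ->
  [:: (a, b); (a', b')] =br [:: (c, d)].
Proof.
move=> H; apply: brauer_trans (brauer_sym (symbols1 _ _)).
apply: brauer_trans H; rewrite symbols_cons.
exact: brauer_tens (brauer_refl _) (symbols1 _ _).
Qed.

Lemma symbols_trivial s : (forall p, p \in s -> brauer_trivial (quat p.1 p.2)) ->
  brauer_trivial (symbols s).
Proof.
elim: s => [|p s IH] H; first by rewrite symbols0; apply: brauer_refl.
rewrite symbols_cons; apply: brauer_trans (brauer_trivial_tensl _ _) (IH _).
  exact: H (mem_head _ _).
by move=> q qs; apply: H; rewrite inE qs orbT.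
Qed.

Lemma symbols_bigtens n (s : n.-tuple (K * K)) :
  bigtens (fun i => quat (tnth s i).1 (tnth s i).2 : falgType K) = symbols s.
Proof. by rewrite /bigtens /symbols [RHS]big_tuple. Qed.

Lemma bigtens_equiv n (A B : 'I_n -> falgType K) :
  (forall i, brauer_equiv (A i) (B i)) -> brauer_equiv (bigtens A) (bigtens B).
Proof.
move=> AB; rewrite /bigtens; elim/big_ind2: _ => [|B1 A1 B2 A2|i _] //.
  exact: brauer_refl.
exact: brauer_tens.
Qed.

End Symbols.

Lemma scalar_ext_symbols (K L : fieldType) (phi : {rmorphism K -> L}) (s : seq (K * K)) :
  brauer_equiv (scalar_ext phi (symbols s))
               (symbols [seq (phi p.1, phi p.2) | p <- s]).
Proof.
elim: s => [|p s IH]; first by rewrite !symbols0; apply/isom_brauer/scalar_ext1.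
rewrite map_cons !symbols_cons /=.
apply: brauer_trans (isom_brauer (scalar_ext_tens _ _ _)) _.
exact: brauer_tens (isom_brauer (scalar_ext_quat _ _ _)) IH.
Qed.

Section QuadraticDescent.
Variables (F : fieldType) (K : fieldExtType F).
Hypotheses (F2 : 2%N \in [pchar F]) (sqK : forall x : K, x ^+ 2 \in 1%VS).
Local Notation frob := (frobenius F2 sqK).

Let K2 : 2%N \in [pchar K]. Proof. by rewrite pchar_lalg. Qed.

Definition ext_symbols (s : seq (F * F)) : seq (K * K) :=
  [seq (p.1%:A, p.2%:A) | p <- s].

Lemma frob_in_alg c : frob c%:A = c ^+ 2.
Proof. by apply: (fmorph_inj (in_alg K)); rewrite /= frobeniusE exprZn expr1n. Qed.

(** Once the second slot is in F, squaring the first slot puts the whole symbol over F. *)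
Lemma symbols_descent (a : K) (c : F) : c != 0 ->
  [:: (a, c%:A)] =br ext_symbols [:: (frob a, c)].
Proof.
move=> c0; apply: symbols_isom; rewrite /= frobeniusE; apply/alg_isom_sym.
by apply: quat_sqr => //; rewrite scaler_eq0 oner_eq0 orbF.
Qed.

Hypothesis dimK : \dim {:K} = 2%N.

(** The degenerate cases are b_1 in F, b_2 in F and b_2 in F b_1: there a symbol descends at once,
    after splitting off a scalar in the last case. *)
Lemma symbols_merge (a1 b1 a2 b2 : K) : b1 != 0 -> b2 != 0 ->
  exists (a b : K) (s : seq (F * F)),
    [/\ b != 0, (size s <= 2)%N, all (fun p => p.2 != 0) s &
        [:: (a1, b1); (a2, b2)] =br (a, b) :: ext_symbols s].
Proof.
move=> b10 b20.
have [/vlineP[c b1E]|b1F] := boolP (b1 \in 1%VS).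
  have c0 : c != 0 by apply: contra b10 => /eqP c0; rewrite b1E c0 scale0r.
  exists a2, b2, [:: (frob a1, c)]; split=> //=; first by rewrite c0.
  apply: brauer_trans (symbols_perm (t := [:: (a2, b2)] ++ [:: (a1, b1)]) _) _.
    by rewrite (perm_catC [:: (a1, b1)]).
  apply: (symbols_cat_equiv (brauer_refl (symbols [:: (a2, b2)]))).
  by rewrite b1E; apply: symbols_descent.
have [y [x b2E]] := quadratic_span (subvf 1) dimK (memvf b1) b1F (memvf b2).
have [y0|y0] := eqVneq y 0.
  move: b2E; rewrite y0 scale0r add0r => b2E.
  have x0 : x != 0 by apply: contra b20 => /eqP x0; rewrite b2E x0 scale0r.
  exists a1, b1, [:: (frob a2, x)]; split=> //=; first by rewrite x0.
  apply: (symbols_cat_equiv (brauer_refl (symbols [:: (a1, b1)]))).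
  by rewrite b2E; apply: symbols_descent.
have nz (c : F) : c != 0 -> c%:A != 0 :> K.
  by move=> c0; rewrite scaler_eq0 oner_eq0 orbF.
have [x0|x0] := eqVneq x 0.
  move: b2E; rewrite x0 scale0r addr0 -mulr_algl => b2E.
  exists (a1 + a2), b1, [:: (frob a2, y)]; split=> //=; first by rewrite y0.
  have H : [:: (a2, b2)] =br [:: (a2, y%:A); (a2, b1)].
    rewrite b2E; apply/brauer_sym/symbols2.
    by apply: symbol_mul => //; apply: nz.
  apply: brauer_trans (symbols_cat_equiv (brauer_refl (symbols [:: (a1, b1)])) H) _.
  apply: brauer_trans (symbols_perm
    (t := [:: (a1, b1); (a2, b1)] ++ [:: (a2, y%:A)]) _) _.
    by rewrite /= perm_cons (perm_catC [:: _] [:: _]).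
  apply: (symbols_cat_equiv (s' := [:: (a1 + a2, b1)])
    (t' := ext_symbols [:: (frob a2, y)]) _ (symbols_descent _ y0)).
  exact/symbols2/symbol_add.
(* Generic case: b_2 = x + y b_1 = x (1 + z) with z = w b_1. After [quat_slot], bilinearity isolates
   [c, b_1), which is absorbed by [a_1, b_1). *)
pose w := y / x; have w0 : w != 0 by rewrite mulf_neq0 ?invr_eq0.
pose z := w%:A * b1; have z0 : z != 0 by rewrite mulf_neq0 ?nz.
have b2E' : b2 = x%:A * (1 + z).
  by rewrite /z !mulr_algl scalerDr scalerA mulrC divfK // addrC.
have z1 : 1 + z != 0 by apply: contra b20 => /eqP z1; rewrite b2E' z1 mulr0.
pose c := a2 * z / (1 + z).
exists (a1 + c), b1, [:: (frob a2, x); (frob c, w)]; split=> //=; first by rewrite x0 w0.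
have H1 : [:: (a2, b2)] =br [:: (a2, x%:A)] ++ [:: (a2, 1 + z)].
  by apply: brauer_sym; rewrite b2E'; apply: symbols2; apply: symbol_mul => //; apply: nz.
have H2 : [:: (a2, 1 + z)] =br [:: (c, w%:A); (c, b1)].
  apply: brauer_trans (symbols_isom (alg_isom_sym (quat_slot K2 a2 z0 z1))) _.
  by apply: brauer_sym; apply: symbols2; apply: symbol_mul => //; apply: nz.
have H3 := brauer_trans H1 (symbols_cat_equiv (brauer_refl _) H2).
apply: brauer_trans (symbols_cat_equiv (brauer_refl (symbols [:: (a1, b1)])) H3) _.
apply: brauer_trans (symbols_perm
    (t := [:: (a1, b1); (c, b1)] ++ [:: (a2, x%:A)] ++ [:: (c, w%:A)]) _) _.
  by rewrite /= perm_cons (perm_catC [:: _; _] [:: _]).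
apply: (symbols_cat_equiv (s' := [:: (a1 + c, b1)])
  (t' := ext_symbols [:: (frob a2, x); (frob c, w)])).
  exact/symbols2/symbol_add.
exact: (symbols_cat_equiv (symbols_descent a2 x0) (symbols_descent c w0)).
Qed.

(** Each new symbol is merged with the one left over from the tail, at the cost of at most two
    symbols over F. *)
Lemma symbols_reduce (l : seq (K * K)) p : all (fun p => p.2 != 0) (p :: l) ->
  exists (a b : K) (s : seq (F * F)),
    [/\ b != 0, (size s <= 2 * size l)%N, all (fun p => p.2 != 0) s &
        p :: l =br (a, b) :: ext_symbols s].
Proof.
elim: l p => [|p2 l IH] p /=.
  rewrite andbT => p0; exists p.1, p.2, [::]; split=> //.
  by rewrite -surjective_pairing; apply: brauer_refl.
case/and3P=> p0 p20 l0; have [|a [b [s [b0 ss s0 E]]]] := IH p2; first exact/andP.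
have [a' [b' [s' [b'0 ss' s'0 E']]]] := symbols_merge p.1 a p0 b0.
exists a', b', (s' ++ s); split=> //.
- by rewrite size_cat mulnS leq_add.
- by rewrite all_cat s'0.
apply: brauer_trans (symbols_cat_equiv (brauer_refl (symbols [:: p])) E) _.
rewrite [p]surjective_pairing /ext_symbols map_cat.
exact: (symbols_cat_equiv E' (brauer_refl (symbols (ext_symbols s)))).
Qed.

Lemma symbol_frob_split (a b : K) : b != 0 -> brauer_trivial (quat (frob a) (frob b)) ->
  exists c d : F, d != 0 /\ [:: (a, b)] =br ext_symbols [:: (c, d)].
Proof.
move=> b0 tr; have fb0 : frob b != 0 by rewrite fmorph_eq0.
have [s [t /(congr1 (in_alg K))]] := quat_split_norm F2 fb0 tr.
rewrite !(rmorphD, rmorphM, rmorphXn) /= !frobeniusE.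
set S := s%:A; set T := t%:A => bE.
have [t0|t0] := eqVneq t 0.
  (* Here b^2 = S^2, and squaring is injective in characteristic 2. *)
  have bS : b = S.
    apply: (fmorph_inj (pFrobenius_aut K2)); rewrite /= !pFrobenius_autE bE.
    by have -> : T = 0; [rewrite /T t0 scale0r | ring].
  have s0 : s != 0 by apply: contra b0 => /eqP s0; rewrite bS /S s0 scale0r.
  by exists (frob a), s; split=> //; rewrite bS; apply: symbols_descent.
have T0 : T != 0 by rewrite /T scaler_eq0 oner_eq0 orbF.
exists (frob (b / T)), t; split=> //.
apply: brauer_trans (symbols_descent _ t0).
(* Dividing the norm equation by T^2 gives a^2 = u^2 + S / T, while b / T = u + S / T; hence b / T =
   a^2 + u^2 + u, and [quat_shift] replaces a^2 by b / T in the first slot. *)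
pose u := (b + S) / T.
have bT0 : b / T != 0 by rewrite mulf_neq0 ?invr_eq0.
have H1 : alg_isom (quat (b / T) b) (quat a b).
  apply: alg_isom_trans (quat_sqr K2 a b0).
  have -> : b / T = a ^+ 2 + u ^+ 2 + u + 0 ^+ 2 * b.
    have -> : u ^+ 2 = (b ^+ 2 + (b * S) *+ 2 + S ^+ 2) / T ^+ 2 by rewrite /u; field.
    apply: (char2_eq K2 (z := - (a ^+ 2 + S / T + (S ^+ 2 + b * S) / T ^+ 2))).
    by rewrite bE /u; field.
  exact: quat_shift.
apply: brauer_trans (symbols_isom (alg_isom_sym H1)) _.
(* Split b as T times b / T: the symbol [b / T, b / T) is trivial, and the other one has its second
   slot in F. *)
have H2 : [:: (b / T, T); (b / T, b / T)] =br [:: (b / T, b)].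
  have := symbol_mul K2 (b / T) T0 bT0; rewrite [T * _]mulrC divfK //.
  exact: symbols2.
apply: brauer_trans (brauer_sym H2) _; rewrite !symbols_cons symbols0.
apply: brauer_tens (brauer_refl _) _.
apply: brauer_trivial_tensl; exact: symbol_self.
Qed.

End QuadraticDescent.

Theorem proposition2p4 (F : fieldType) (K : fieldExtType F)
  (charF2 : 2%N \in [pchar F])
  (quadK : \dim {:K} = 2%N) (insepK : ~~ separable 1 {:K})
  (A : falgType K) (csA : central_simple A) (expA : has_exponent A 2)
  (m : nat) (m_ge1 : (1 <= m)%N)
  (Q : 'I_m -> falgType K) (quatQ : forall i, quaternion_algebra (Q i))
  (eqAQ : brauer_equiv A (bigtens Q))
  (frobA0 : brauer_trivial
     (scalar_ext (frobenius charF2 (insep_quadratic_sqr charF2 quadK insepK)) A)) :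
  exists (n : nat) (H : 'I_n -> falgType F),
    [/\ (n <= 2 * m - 1)%N,
        forall i, quaternion_algebra (H i)
      & brauer_equiv A (scalar_ext (in_alg K) (bigtens H))].
Proof.
have K2 : 2%N \in [pchar K] by rewrite pchar_lalg.
set sqK := insep_quadratic_sqr _ _ _ in frobA0.
have [f fP] : exists f : 'I_m -> K * K, forall i, (f i).2 != 0 /\
    alg_isom (quat (f i).1 (f i).2) (Q i).
  apply: (fin_all_exists
    (P := fun i p => p.2 != 0 /\ alg_isom (quat p.1 p.2) (Q i))) => i.
  have [cs d4] := quatQ i.
  by have [a [b [b0 iso]]] := quaternionP cs d4 K2; exists (a, b).
pose l := [tuple f i | i < m].
have Al : brauer_equiv A (symbols l).
  apply: brauer_trans eqAQ _; rewrite -symbols_bigtens.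
  apply: bigtens_equiv => i; rewrite tnth_mktuple.
  exact/isom_brauer/alg_isom_sym/(fP i).2.
have l0 : all (fun p => p.2 != 0) l.
  by apply/all_tnthP=> i; rewrite tnth_mktuple (fP i).1.
have sl : size l = m by rewrite size_tuple.
case lE : (val l) sl => [|p l'] /= sl; first by rewrite -sl in m_ge1.
rewrite lE in l0 Al.
have [a [b [s [b0 ss s0 E]]]] := symbols_reduce charF2 sqK quadK l0.
have AE := brauer_trans Al E.
(* Frobenius squares elements of F, so it sends each symbol extended from F to one with a square in
   the second slot, which is split. Only the image of [a, b) remains. *)
have tr : brauer_trivial (quat (frobenius charF2 sqK a) (frobenius charF2 sqK b)).
  have := brauer_trans (brauer_sym (scalar_ext_brauer (frobenius charF2 sqK) AE)) frobA0.
  move=> /(brauer_trans (brauer_sym (scalar_ext_symbols _ _))).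
  rewrite map_cons symbols_cons /=; apply: brauer_trans.
  apply: brauer_sym; apply: brauer_trivial_tensr.
  apply: symbols_trivial => q /mapP[q' /mapP[r rs ->] ->] /=.
  rewrite !frob_in_alg; apply: symbol_sqr => //.
  exact: (allP s0).
have [c [d [d0 E1]]] := symbol_frob_split b0 tr.
have AE' : brauer_equiv A (symbols (ext_symbols K ((c, d) :: s))).
  apply: brauer_trans AE _.
  exact: (symbols_cat_equiv E1 (brauer_refl (symbols (ext_symbols K s)))).
pose r := in_tuple ((c, d) :: s).
exists (size r), (fun i => quat (tnth r i).1 (tnth r i).2 : falgType F); split=> [|i|].
(* One symbol from [a, b) and at most 2 (m - 1) from the reduction. *)
- move: ss sl => /=; lia.
- apply: quat_quaternion => //.
  have : all (fun p => p.2 != 0) r by rewrite /= d0.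
  by move/all_tnthP.
rewrite symbols_bigtens; apply: brauer_trans AE' _.
exact: brauer_sym (scalar_ext_symbols (in_alg K) _).
Qed.
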